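(* Let $A$ be a $C^*$-algebra with real rank zero. If $\mathrm{V}(A)$ has weak divisibility for order units and is strictly unperforated, then the subsemigroup of $\mathrm{V}(A)$ consisting of the equivalence classes of full projections is cancellative (that is, if $a,b,c$ belong to this subsemigroup and $a+c=b+c$, then $a=b$).
   Context: A $C^*$-algebra has real rank zero if (in it, or in its unitization if it is non-unital) the invertible self-adjoint elements are dense in the self-adjoint elements. $\mathrm{V}(A)$ is the abelian monoid of Murray-von Neumann equivalence classes $[p]$ of projections in $M_\infty(A)=\bigcup_n M_n(A)$, with $[p]+[q]=[p\oplus q]$ (projections $p,q$ are Murray-von Neumann equivalent if $p=vv^*$ and $q=v^*v$ for a partial isometry $v$). It carries the algebraic ordering: $x\le y$ if $x+z=y$ for some $z\in \mathrm{V}(A)$. A projection is full if the closed two-sided ideal it generates is the whole algebra; classes of full projections (in matrix algebras over $A$) are exactly the order units of $\mathrm{V}(A)$, where an order unit in a monoid $M$ is a non-zero $u\in M$ such that for every $x\in M$ there is $n\in\mathbb{N}$ with $x\le nu$. A monoid $M$ has weak divisibility for order units if every order unit $u$ of $M$ can be written $u=2a+3b$ with $a,b\in M$. A monoid $M$ is strictly unperforated if whenever $nx+z=ny$ for $x,y,z\in M$ with $z\ne0$ and $n\in\mathbb{N}$, there is a non-zero $w\in M$ with $x+w=y$. *)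

(* Defs.v *)
From HB Require Import structures.
From mathcomp Require Import all_boot all_order all_algebra.
From mathcomp Require Import all_classical all_reals all_analysis.
From mathcomp.real_closed Require Import complex.

Set Implicit Arguments.
Unset Strict Implicit.
Unset Printing Implicit Defensive.

Import Order.TTheory GRing.Theory Num.Theory.
Import numFieldNormedType.Exports.

Local Open Scope classical_set_scope.
Local Open Scope ring_scope.
Local Open Scope complex_scope.
Local Open Scope quotient_scope.

(* C*-algebras are complex and need not be unital, hence the ring structures
   of ssralg do not apply.  The norm takes its values in [R[i]]. *)
HB.mixin Record isCStarAlgebra (R : realType) A of CompleteNormedModule R[i] A := {
  cmul : A -> A -> A;
  cadj : A -> A;
  cmulA : associative cmul;
  cmulDl : left_distributive cmul +%R;
  cmulDr : right_distributive cmul +%R;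
  cmulZl : forall (k : R[i]) (x y : A), cmul (k *: x) y = k *: cmul x y;
  cmulZr : forall (k : R[i]) (x y : A), cmul x (k *: y) = k *: cmul x y;
  cadjD : {morph cadj : x y / x + y};
  cadjZ : forall (k : R[i]) (x : A), cadj (k *: x) = k^* *: cadj x;
  cadjM : forall x y : A, cadj (cmul x y) = cmul (cadj y) (cadj x);
  cadjK : involutive cadj;
  cnormM : forall x y : A, `|cmul x y| <= `|x| * `|y|;
  cnorm_cstar : forall x : A, `|cmul (cadj x) x| = `|x| ^+ 2;
}.

#[short(type="cstarAlgType")]
HB.structure Definition CStarAlgebra (R : realType) :=
  { A of CompleteNormedModule R[i] A & isCStarAlgebra R A }.

Section RealRankZero.
Variables (R : realType) (A : cstarAlgType R).

Definition is_unit (e : A) : Prop := forall x : A, cmul e x = x /\ cmul x e = x.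

Definition unital : Prop := exists e : A, is_unit e.

(* The unitization is carried by [A * R[i]^o], where [(x, k)] stands for
   [x + k 1].  When A is not unital, its C*-norm is equivalent to the product
   norm, so it induces the product topology. *)
Definition unitization_mul (x y : A * R[i]^o) : A * R[i]^o :=
  (cmul x.1 y.1 + y.2 *: x.1 + x.2 *: y.1, x.2 * y.2).

Definition unitization_adj (x : A * R[i]^o) : A * R[i]^o := (cadj x.1, x.2^*).

Definition invertible_sa_dense (T : topologicalType) (mul : T -> T -> T)
    (adj : T -> T) (e : T) : Prop :=
  [set x | adj x = x] `<=`
  closure [set x | adj x = x /\ exists y, mul x y = e /\ mul y x = e].

Definition real_rank_zero : Prop :=
  (forall e : A, is_unit e -> invertible_sa_dense (@cmul R A) (@cadj R A) e) /\
  (~ unital -> invertible_sa_dense unitization_mul unitization_adj (0, 1)).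

End RealRankZero.

Section MatrixAlgebra.
Variables (R : realType) (A : cstarAlgType R).

Definition mxmul m n p (x : 'M[A]_(m, n)) (y : 'M[A]_(n, p)) : 'M[A]_(m, p) :=
  \matrix_(i, k) \sum_j cmul (x i j) (y j k).

Definition mxadj m n (x : 'M[A]_(m, n)) : 'M[A]_(n, m) :=
  \matrix_(i, j) cadj (x j i).

Definition two_sided_ideal n (I : set 'M[A]_n) : Prop :=
  [/\ I 0, forall x y, I x -> I y -> I (x + y),
      forall (k : R[i]) x, I x -> I (map_mx ( *:%R k) x) &
      forall x y, I y -> I (mxmul x y) /\ I (mxmul y x)].

(* [closed] refers to the entrywise topology of the matrices over A, which is
   the one given by the C*-norm of this matrix algebra. *)
Definition closed_ideal_gen n (x : 'M[A]_n) : set 'M[A]_n :=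
  smallest [set I | two_sided_ideal I /\ closed I] [set x].

Definition partial_isometry m n (v : 'M[A]_(m, n)) : Prop :=
  mxmul (mxmul v (mxadj v)) v = v.

Lemma cmul0l (x : A) : cmul 0 x = 0.
Proof. by apply: (addrI (cmul 0 x)); rewrite -cmulDl !addr0. Qed.

Lemma cmul0r (x : A) : cmul x 0 = 0.
Proof. by apply: (addrI (cmul x 0)); rewrite -cmulDr !addr0. Qed.

Lemma cadj0 : cadj 0 = 0 :> A.
Proof. by apply: (addrI (cadj 0)); rewrite -cadjD !addr0. Qed.

Lemma cmul_suml I (r : seq I) (F : I -> A) y :
  cmul (\sum_(i <- r) F i) y = \sum_(i <- r) cmul (F i) y.
Proof.
by apply: (big_morph (fun x => cmul x y)) => [a b|]; rewrite ?cmulDl ?cmul0l.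
Qed.

Lemma cmul_sumr I (r : seq I) (F : I -> A) y :
  cmul y (\sum_(i <- r) F i) = \sum_(i <- r) cmul y (F i).
Proof.
by apply: (big_morph (cmul y)) => [a b|]; rewrite ?cmulDr ?cmul0r.
Qed.

Lemma cadj_sum I (r : seq I) (F : I -> A) :
  cadj (\sum_(i <- r) F i) = \sum_(i <- r) cadj (F i).
Proof. by apply: (big_morph (@cadj R A)) => [a b|]; rewrite ?cadjD ?cadj0. Qed.

Lemma mxmulA m n p q (x : 'M[A]_(m, n)) (y : 'M[A]_(n, p)) (z : 'M[A]_(p, q)) :
  mxmul x (mxmul y z) = mxmul (mxmul x y) z.
Proof.
apply/matrixP => i l; rewrite !mxE.
under eq_bigr => j _ do rewrite mxE cmul_sumr.
rewrite exchange_big; apply: eq_bigr => k _; rewrite mxE cmul_suml.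
by apply: eq_bigr => j _; rewrite cmulA.
Qed.

Lemma mxadjM m n p (x : 'M[A]_(m, n)) (y : 'M[A]_(n, p)) :
  mxadj (mxmul x y) = mxmul (mxadj y) (mxadj x).
Proof.
apply/matrixP => i k; rewrite !mxE cadj_sum.
by apply: eq_bigr => j _; rewrite cadjM !mxE.
Qed.

Lemma mxadjK m n (x : 'M[A]_(m, n)) : mxadj (mxadj x) = x.
Proof. by apply/matrixP => i j; rewrite !mxE cadjK. Qed.

Lemma mxadj0 m n : mxadj 0 = 0 :> 'M[A]_(m, n).
Proof. by apply/matrixP => i j; rewrite !mxE cadj0. Qed.

Lemma mxmul0l m n p (x : 'M[A]_(n, p)) : mxmul 0 x = 0 :> 'M[A]_(m, p).
Proof. by apply/matrixP => i j; rewrite !mxE big1 // => k _; rewrite mxE cmul0l. Qed.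

Lemma mxmul0r m n p (x : 'M[A]_(m, n)) : mxmul x 0 = 0 :> 'M[A]_(m, p).
Proof. by apply/matrixP => i j; rewrite !mxE big1 // => k _; rewrite mxE cmul0r. Qed.

Lemma mxmul_row_col m n1 n2 p (x : 'M[A]_(m, n1)) y (z : 'M[A]_(n1, p)) (t : 'M[A]_(n2, p)) :
  mxmul (row_mx x y) (col_mx z t) = mxmul x z + mxmul y t.
Proof.
apply/matrixP => i j; rewrite !mxE big_split_ord /=.
by congr (_ + _); apply: eq_bigr => k _;
  rewrite ?row_mxEl ?row_mxEr ?col_mxEu ?col_mxEd.
Qed.

Lemma mxmul_col m1 m2 n p (x : 'M[A]_(m1, n)) (y : 'M[A]_(m2, n)) (z : 'M[A]_(n, p)) :
  mxmul (col_mx x y) z = col_mx (mxmul x z) (mxmul y z).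
Proof.
apply/matrixP => i j; rewrite !mxE; case: split_ordP => k ->; rewrite mxE;
by apply: eq_bigr => l _; rewrite ?col_mxEu ?col_mxEd.
Qed.

Lemma mxmul_row m n p1 p2 (x : 'M[A]_(m, n)) (y : 'M[A]_(n, p1)) (z : 'M[A]_(n, p2)) :
  mxmul x (row_mx y z) = row_mx (mxmul x y) (mxmul x z).
Proof.
apply/matrixP => i j; rewrite !mxE; case: split_ordP => k ->; rewrite mxE;
by apply: eq_bigr => l _; rewrite ?row_mxEl ?row_mxEr.
Qed.

Lemma mxmul_block m1 m2 n1 n2 p1 p2
  (a : 'M[A]_(m1, n1)) (b : 'M[A]_(m1, n2)) (c : 'M[A]_(m2, n1)) (d : 'M[A]_(m2, n2))
  (a' : 'M[A]_(n1, p1)) (b' : 'M[A]_(n1, p2)) (c' : 'M[A]_(n2, p1)) (d' : 'M[A]_(n2, p2)) :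
  mxmul (block_mx a b c d) (block_mx a' b' c' d') =
  block_mx (mxmul a a' + mxmul b c') (mxmul a b' + mxmul b d')
           (mxmul c a' + mxmul d c') (mxmul c b' + mxmul d d').
Proof.
by rewrite [X in mxmul X _]/block_mx mxmul_col !block_mxEh !mxmul_row
  !mxmul_row_col -block_mxEv block_mxEh.
Qed.

Lemma mxadj_col m1 m2 n (x : 'M[A]_(m1, n)) (y : 'M[A]_(m2, n)) :
  mxadj (col_mx x y) = row_mx (mxadj x) (mxadj y).
Proof.
apply/matrixP => i j; case: (split_ordP j) => k ->;
by rewrite ?row_mxEl ?row_mxEr mxE ?col_mxEu ?col_mxEd [RHS]mxE.
Qed.

Lemma mxadj_row m n1 n2 (x : 'M[A]_(m, n1)) (y : 'M[A]_(m, n2)) :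
  mxadj (row_mx x y) = col_mx (mxadj x) (mxadj y).
Proof.
apply/matrixP => i j; case: (split_ordP i) => k ->;
by rewrite ?col_mxEu ?col_mxEd mxE ?row_mxEl ?row_mxEr [RHS]mxE.
Qed.

Lemma mxadj_block m1 m2 n1 n2
  (a : 'M[A]_(m1, n1)) (b : 'M[A]_(m1, n2)) (c : 'M[A]_(m2, n1)) (d : 'M[A]_(m2, n2)) :
  mxadj (block_mx a b c d) = block_mx (mxadj a) (mxadj c) (mxadj b) (mxadj d).
Proof. by rewrite /block_mx mxadj_col !mxadj_row -block_mxEh. Qed.

(* [pmx] is a projection of [M_n(A)] for n = [psize].+1, so that n >= 1. *)
Record projection := Projection {
  psize : nat;
  pmx : 'M[A]_(psize.+1);
  pmx_adj : mxadj pmx = pmx;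
  pmx_idem : mxmul pmx pmx = pmx }.

HB.instance Definition _ := gen_eqMixin projection.
HB.instance Definition _ := gen_choiceMixin projection.

Definition full (p : projection) : Prop := closed_ideal_gen (pmx p) = setT.

(* A rectangular v is the same as an element of [M_oo(A)] supported in the
   corresponding corner. *)
Definition murray_von_neumann (p q : projection) : Prop :=
  exists v : 'M[A]_((psize p).+1, (psize q).+1),
    [/\ partial_isometry v, pmx p = mxmul v (mxadj v) &
        pmx q = mxmul (mxadj v) v].

Lemma mvn_refl p : murray_von_neumann p p.
Proof. by exists (pmx p); rewrite /partial_isometry pmx_adj !pmx_idem. Qed.

Lemma mvn_sym p q : murray_von_neumann p q -> murray_von_neumann q p.
Proof.
move=> [v [vP pE qE]]; exists (mxadj v); rewrite /partial_isometry mxadjK.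
by split => //; rewrite -[in RHS]vP !mxadjM mxadjK mxmulA.
Qed.

Lemma mvn_trans p q r : murray_von_neumann p q -> murray_von_neumann q r ->
  murray_von_neumann p r.
Proof.
move=> [v [vP pE qE]] [w [wP qE' rE]].
have vq : mxmul v (pmx q) = v by rewrite qE mxmulA.
have qw : mxmul (pmx q) w = w by rewrite qE'.
have E1 : pmx p = mxmul (mxmul v w) (mxadj (mxmul v w)).
  by rewrite mxadjM mxmulA -(mxmulA v w) -qE' vq -pE.
exists (mxmul v w); split => //.
  by rewrite /partial_isometry -E1 pE mxmulA vP.
by rewrite mxadjM mxmulA -(mxmulA _ (mxadj v)) -qE -mxmulA qw -rE.
Qed.

Definition mvn_rel (p q : projection) : bool := `[< murray_von_neumann p q >].

Lemma mvn_rel_refl : reflexive mvn_rel.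
Proof. by move=> p; apply/asboolP/mvn_refl. Qed.

Lemma mvn_rel_sym : symmetric mvn_rel.
Proof. by move=> p q; apply/asboolP/asboolP; apply: mvn_sym. Qed.

Lemma mvn_rel_trans : transitive mvn_rel.
Proof.
by move=> q p r /asboolP pq /asboolP qr; apply/asboolP; apply: mvn_trans pq qr.
Qed.

Canonical mvn_equiv := EquivRel mvn_rel mvn_rel_refl mvn_rel_sym mvn_rel_trans.

Definition V := {eq_quot mvn_equiv}.
HB.instance Definition _ := Choice.on V.
HB.instance Definition _ := EqQuotient.on V.

Definition V_class (p : projection) : V := \pi_V p.

Lemma V_classP p q : V_class p = V_class q <-> murray_von_neumann p q.
Proof.
split=> [/eqP|pq]; first by rewrite eqmodE => /asboolP.
by apply/eqP; rewrite eqmodE; apply/asboolP.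
Qed.

Definition proj0 : projection :=
  @Projection 0 0 (mxadj0 _ _) (mxmul0l _ _).

Definition dsum_mx (p q : projection) :
    'M[A]_((psize p).+1 + (psize q).+1) := block_mx (pmx p) 0 0 (pmx q).

Lemma dsum_adj p q : mxadj (dsum_mx p q) = dsum_mx p q.
Proof. by rewrite mxadj_block !mxadj0 !pmx_adj. Qed.

Lemma dsum_idem p q : mxmul (dsum_mx p q) (dsum_mx p q) = dsum_mx p q.
Proof.
by rewrite mxmul_block !mxmul0l !mxmul0r !pmx_idem !addr0 !add0r.
Qed.

Definition dsum (p q : projection) : projection :=
  @Projection (psize p + (psize q).+1) (dsum_mx p q) (dsum_adj p q) (dsum_idem p q).

Lemma mvn_dsum p p' q q' : murray_von_neumann p p' -> murray_von_neumann q q' ->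
  murray_von_neumann (dsum p q) (dsum p' q').
Proof.
move=> [v [vP pE p'E]] [w [wP qE q'E]].
pose u : 'M[A]_((psize p).+1 + (psize q).+1, (psize p').+1 + (psize q').+1) :=
  block_mx v 0 0 w.
have uu : mxmul u (mxadj u) = dsum_mx p q.
  by rewrite /u mxadj_block mxmul_block !mxadj0 !mxmul0l !mxmul0r !addr0 !add0r
    /dsum_mx pE qE.
exists u; split => //.
  change (mxmul (mxmul u (mxadj u)) u = u).
  by rewrite uu /dsum_mx /u mxmul_block !mxmul0l !mxmul0r !addr0 !add0r pE qE
    vP wP.
change (dsum_mx p' q' = mxmul (mxadj u) u).
by rewrite /u mxadj_block mxmul_block !mxadj0 !mxmul0l !mxmul0r !addr0 !add0r
  /dsum_mx p'E q'E.
Qed.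

Lemma mvn_dsumC p q : murray_von_neumann (dsum p q) (dsum q p).
Proof.
pose u : 'M[A]_((psize p).+1 + (psize q).+1, (psize q).+1 + (psize p).+1) :=
  block_mx 0 (pmx p) (pmx q) 0.
have uu : mxmul u (mxadj u) = dsum_mx p q.
  by rewrite /u mxadj_block mxmul_block !mxadj0 !pmx_adj !mxmul0l !mxmul0r
    !addr0 !add0r !pmx_idem.
exists u; split => //.
  change (mxmul (mxmul u (mxadj u)) u = u).
  by rewrite uu /dsum_mx /u mxmul_block !mxmul0l !mxmul0r
    !addr0 !add0r !pmx_idem.
change (dsum_mx q p = mxmul (mxadj u) u).
by rewrite /u mxadj_block mxmul_block !mxadj0 !pmx_adj !mxmul0l !mxmul0r
  !addr0 !add0r !pmx_idem.
Qed.

Lemma mvn_dsum0 p : murray_von_neumann (dsum proj0 p) p.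
Proof.
pose u : 'M[A]_(1 + (psize p).+1, (psize p).+1) := col_mx 0 (pmx p).
have uu : mxmul u (mxadj u) = dsum_mx proj0 p.
  by rewrite /u mxadj_col mxmul_col !mxmul_row mxadj0 pmx_adj !mxmul0l !mxmul0r
    pmx_idem.
exists u; split => //.
  change (mxmul (mxmul u (mxadj u)) u = u).
  by rewrite uu /dsum_mx /u block_mxEv mxmul_col
    !mxmul_row_col !mxmul0l pmx_idem !addr0 !add0r.
change (pmx p = mxmul (mxadj u) u).
by rewrite /u mxadj_col mxmul_row_col mxmul0r pmx_adj pmx_idem add0r.
Qed.

Lemma projection_eq (p q : projection) (e : (psize p).+1 = (psize q).+1) :
  castmx (e, e) (pmx p) = pmx q -> p = q.
Proof.
case: p q e => [n x xa xi] [m y ya yi] /= e.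
have nm : n = m by case: e.
move: e y ya yi; rewrite -nm => e y ya yi.
rewrite castmx_id => xy; move: xa xi; rewrite xy => xa xi.
by congr Projection; apply: Prop_irrelevance.
Qed.

Lemma block_diag_mxA n1 n2 n3
    (x : 'M[A]_n1) (y : 'M[A]_n2) (z : 'M[A]_n3) :
  castmx (addnA n1 n2 n3, addnA n1 n2 n3)
    (block_mx x 0 0 (block_mx y 0 0 z)) = block_mx (block_mx x 0 0 y) 0 0 z.
Proof.
have := @block_mxA A n1 n2 n3 n1 n2 n3 x 0 0 0 y 0 0 0 z.
rewrite /= !row_mx0 !col_mx0 => ->.
by rewrite castmx_comp /= castmx_id.
Qed.

Lemma dsumA : associative dsum.
Proof.
move=> p q r.
apply: (@projection_eq (dsum p (dsum q r)) (dsum (dsum p q) r)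
  (addnA (psize p).+1 (psize q).+1 (psize r).+1)).
exact (block_diag_mxA (pmx p) (pmx q) (pmx r)).
Qed.

Definition V_add (x y : V) : V := V_class (dsum (repr x) (repr y)).

Lemma V_addE p q : V_add (V_class p) (V_class q) = V_class (dsum p q).
Proof.
by apply/V_classP; apply: mvn_dsum; apply/V_classP; rewrite /V_class reprK.
Qed.

Lemma V_ind (P : V -> Prop) : (forall p, P (V_class p)) -> forall x, P x.
Proof. by move=> PV x; rewrite -[x]reprK; apply: PV. Qed.

Lemma V_addA : associative V_add.
Proof.
elim/V_ind => p; elim/V_ind => q; elim/V_ind => r.
by rewrite !V_addE dsumA.
Qed.

Lemma V_addC : commutative V_add.
Proof.
elim/V_ind => p; elim/V_ind => q; rewrite !V_addE.
by apply/V_classP/mvn_dsumC.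
Qed.

Lemma V_add0 : left_id (V_class proj0) V_add.
Proof. by elim/V_ind => p; rewrite V_addE; apply/V_classP/mvn_dsum0. Qed.

HB.instance Definition _ := GRing.isNmodule.Build V V_addA V_addC V_add0.

Definition full_class (x : V) : Prop := exists2 p, full p & x = V_class p.

End MatrixAlgebra.

Section Monoids.
Variable M : nmodType.

Definition alg_le (x y : M) : Prop := exists z, x + z = y.

Definition order_unit (u : M) : Prop :=
  u <> 0 /\ forall x, exists n : nat, alg_le x (u *+ n).

Definition weak_divisibility_for_order_units : Prop :=
  forall u, order_unit u -> exists a b : M, u = a *+ 2 + b *+ 3.

Definition strictly_unperforated : Prop :=
  forall (x y z : M) (n : nat), z <> 0 -> x *+ n + z = y *+ n ->
  exists w, w <> 0 /\ x + w = y.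

End Monoids.

(* Main.v *)
Require Import Defs.
From HB Require Import structures.
From mathcomp Require Import all_boot all_order all_algebra.
From mathcomp Require Import all_classical all_reals all_analysis.
From mathcomp.real_closed Require Import complex.
From mathcomp Require Import ring lra.

Set Implicit Arguments.
Unset Strict Implicit.
Unset Printing Implicit Defensive.

Import Order.TTheory GRing.Theory Num.Theory.
Import numFieldNormedType.Exports.

Local Open Scope classical_set_scope.
Local Open Scope ring_scope.
Local Open Scope complex_scope.

(* V(A) is a refinement monoid.  By refinement, [c + s' = c + c + x'] can be
   arranged whenever [c + c + x = c + y] with y an order unit, and strict
   unperforation turns it into [x' < s'], so that [y = x + g] with
   [c + g = c + c].  Hence a + d = b + d implies a = b as soon as [d + d <= a];
   weak divisibility provides such an order unit d, and c is cancelled after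
   being replaced by a multiple of d.

   Refinement follows from real rank zero.  V(A) is generated by projections e
   of A, and for those an isomorphism of e + Y with P + Q is cut along a
   projection r <= e that nearly commutes with the image of P in e A e, so that
   the remaining parts of P and Q are matched with Y by a reflection.  The
   functional calculus of a single algebra suffices for this, the unitization
   B of A with its C*-norm; no norm on matrices over A is used.

   A full projection p gives an order unit: a projection q of A is a limit of
   finite sums of elements p_i w_i with p_i a unitary conjugate of a projection
   below p, and the p_i absorb q piece by piece. *)

(** Real rank zero concerns self-adjoint elements of one algebra, whereas refinement concerns
    isomorphisms between matrix projections. The link: as [e] lies in [A], the isomorphism has a row
    [rho] with [rho rho^* = e], along which [P] and [Q] compress to single elements [a] and [e - a]
    of the corner of [e]. Cutting at the level 1/2 makes [a] bounded below on [r] and [e - a]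
    bounded below on [s = e - r]; normalizing the [P]-part of [rho] over [r] and the [Q]-part over
    [s] gives a row [X] with [X X^* = e]. A reflection carrying [rho] to [- X] needs [e + rho X^*]
    to be invertible in the corner: this holds because [rho X^*] is close to a sum of positive
    square roots, and it explains the minus sign. Spectral projections of [a] need not exist in the
    algebra, but those of a nearby invertible element do; hence the error terms and numerical
    constants. In the monoid, the nonzero surplus that strict unperforation demands is a multiple of
    [c + c]. *)

(** * Words in a noncommutative algebra *)

Section NoncommutativeRing.
Variables (K : comNzRingType) (B : algType K).

Inductive ncexp :=
  | NCvar of nat | NCadd of ncexp & ncexp | NCmul of ncexp & ncexp
  | NCopp of ncexp | NCscale of K & ncexp | NCone | NCzero.

Fixpoint nc_eval (env : seq B) (e : ncexp) : B :=
  match e with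
  | NCvar n => nth 0 env n
  | NCadd e1 e2 => nc_eval env e1 + nc_eval env e2
  | NCmul e1 e2 => nc_eval env e1 * nc_eval env e2
  | NCopp e1 => - nc_eval env e1
  | NCscale k e1 => k *: nc_eval env e1
  | NCone => 1
  | NCzero => 0
  end.

(** Equality and concatenation are redefined, with [if] in place of a boolean connective, so that
    the [cbv] of [nc_ring_coef] unfolds exactly these constants and leaves the coefficients in [K]
    untouched. *)
Fixpoint nc_eqn (m n : nat) : bool :=
  match m, n with O, O => true | S m', S n' => nc_eqn m' n' | _, _ => false end.

Fixpoint nc_eqm (m n : list nat) : bool :=
  match m, n with
  | nil, nil => true
  | cons x m', cons y n' => if nc_eqn x y then nc_eqm m' n' else false
  | _, _ => false
  end.

Fixpoint nc_catm (m n : list nat) : list nat :=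
  match m with nil => n | cons x m' => cons x (nc_catm m' n) end.

Fixpoint nc_ins (k : K) (m : list nat) (l : list (K * list nat)) :=
  match l with
  | nil => cons (k, m) nil
  | cons (k', m') l' =>
    if nc_eqm m m' then cons (k' + k, m') l' else cons (k', m') (nc_ins k m l')
  end.

Fixpoint nc_add (l1 l2 : list (K * list nat)) :=
  match l1 with nil => l2 | cons (k, m) l1' => nc_ins k m (nc_add l1' l2) end.

Fixpoint nc_mul1 (k : K) (m : list nat) (l : list (K * list nat)) :=
  match l with
  | nil => nil
  | cons (k', m') l' => nc_ins (k * k') (nc_catm m m') (nc_mul1 k m l')
  end.

Fixpoint nc_mul (l1 l2 : list (K * list nat)) :=
  match l1 with nil => nil | cons (k, m) l1' => nc_add (nc_mul1 k m l2) (nc_mul l1' l2) end.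

Fixpoint nc_scale (k : K) (l : list (K * list nat)) :=
  match l with nil => nil | cons (k', m) l' => cons (k * k', m) (nc_scale k l') end.

Fixpoint nc_norm (e : ncexp) : list (K * list nat) :=
  match e with
  | NCvar n => cons (1, cons n nil) nil
  | NCadd e1 e2 => nc_add (nc_norm e1) (nc_norm e2)
  | NCmul e1 e2 => nc_mul (nc_norm e1) (nc_norm e2)
  | NCopp e1 => nc_scale (-1) (nc_norm e1)
  | NCscale k e1 => nc_scale k (nc_norm e1)
  | NCone => cons (1, nil) nil
  | NCzero => nil
  end.

Fixpoint nc_null (l : list (K * list nat)) : Prop :=
  match l with nil => True | cons (k, _) l' => k = 0 /\ nc_null l' end.

Definition nc_evalm (env : seq B) (m : list nat) : B := foldr (fun n x => nth 0 env n * x) 1 m.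
Definition nc_evall (env : seq B) (l : list (K * list nat)) : B :=
  foldr (fun km x => km.1 *: nc_evalm env km.2 + x) 0 l.

Lemma nc_eqmP m n : nc_eqm m n -> m = n.
Proof.
have eqnP' : forall i j, nc_eqn i j -> i = j by elim=> [|i IH] [|j] //= /IH ->.
by elim: m n => [|x m IH] [|y n] //=; case: ifP => // /eqnP' -> /IH ->.
Qed.

Lemma nc_insE env k m l : nc_evall env (nc_ins k m l) = k *: nc_evalm env m + nc_evall env l.
Proof.
elim: l => [|[k' m'] l IH] //=; case: ifP => [/nc_eqmP ->|_] /=.
  by rewrite scalerDl addrA [k *: _ + _]addrC.
by rewrite IH addrCA.
Qed.

Lemma nc_addE env l1 l2 : nc_evall env (nc_add l1 l2) = nc_evall env l1 + nc_evall env l2.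
Proof. by elim: l1 => [|[k m] l1 IH] /=; rewrite ?add0r // nc_insE IH addrA. Qed.

Lemma nc_catmE env m n : nc_evalm env (nc_catm m n) = nc_evalm env m * nc_evalm env n.
Proof. by elim: m => [|x m IH] /=; rewrite ?mul1r // IH mulrA. Qed.

Lemma nc_mul1E env k m l : nc_evall env (nc_mul1 k m l) = k *: nc_evalm env m * nc_evall env l.
Proof.
elim: l => [|[k' m'] l IH] /=; first by rewrite mulr0.
by rewrite nc_insE IH nc_catmE mulrDr; congr (_ + _); rewrite -scalerAl -scalerAr scalerA.
Qed.

Lemma nc_mulE env l1 l2 : nc_evall env (nc_mul l1 l2) = nc_evall env l1 * nc_evall env l2.
Proof.
by elim: l1 => [|[k m] l1 IH] /=; rewrite ?mul0r // nc_addE IH nc_mul1E mulrDl.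
Qed.

Lemma nc_scaleE env k l : nc_evall env (nc_scale k l) = k *: nc_evall env l.
Proof.
by elim: l => [|[k' m] l IH] /=; rewrite ?scaler0 // IH scalerDr scalerA.
Qed.

Lemma nc_normE env e : nc_evall env (nc_norm e) = nc_eval env e.
Proof.
elim: e => //= [n|e1 IH1 e2 IH2|e1 IH1 e2 IH2|e1 IH1|k e1 IH1|].
- by rewrite scale1r mulr1 addr0.
- by rewrite nc_addE IH1 IH2.
- by rewrite nc_mulE IH1 IH2.
- by rewrite nc_scaleE IH1 scaleN1r.
- by rewrite nc_scaleE IH1.
- by rewrite scale1r addr0.
Qed.

Lemma nc_correct env e1 e2 : nc_null (nc_norm (NCadd e1 (NCopp e2))) ->
  nc_eval env e1 = nc_eval env e2.
Proof.
move=> H; apply/eqP; rewrite -subr_eq0; apply/eqP.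
rewrite (_ : _ - _ = nc_eval env (NCadd e1 (NCopp e2))) // -nc_normE.
by move: H; elim: (nc_norm _) => [|[k m] l IH] //= [-> /IH ->]; rewrite scale0r addr0.
Qed.

End NoncommutativeRing.

(** [unify] is a tactic and returns no term: the dummy matches on [Set] run it while a term is being
    built, and its failure selects the next branch. *)
Ltac nc_index x env :=
  match env with
  | cons ?y ?env' =>
    match constr:(Set) with
    | _ => let _ := match constr:(Set) with _ => unify x y end in constr:(O)
    | _ => let n := nc_index x env' in constr:(S n)
    end
  end.

Ltac nc_mem x env :=
  match env with
  | nil => constr:(false)
  | cons ?y ?env' =>
    match constr:(Set) with
    | _ => let _ := match constr:(Set) with _ => unify x y end in constr:(true)
    | _ => nc_mem x env'
    end
  end.

Ltac nc_atoms env t :=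
  lazymatch t with
  | (?a + ?b)%R => let env := nc_atoms env a in nc_atoms env b
  | (?a * ?b)%R => let env := nc_atoms env a in nc_atoms env b
  | (- ?a)%R => nc_atoms env a
  | (_ *: ?a)%R => nc_atoms env a
  | 1%R => env
  | 0%R => env
  | _ => lazymatch nc_mem t env with true => env | false => constr:(cons t env) end
  end.

Ltac nc_reify K env t :=
  lazymatch t with
  | (?a + ?b)%R => let x := nc_reify K env a in let y := nc_reify K env b in
                   constr:(@NCadd K x y)
  | (?a * ?b)%R => let x := nc_reify K env a in let y := nc_reify K env b in
                   constr:(@NCmul K x y)
  | (- ?a)%R => let x := nc_reify K env a in constr:(@NCopp K x)
  | (?k *: ?a)%R => let x := nc_reify K env a in constr:(@NCscale K k x)
  | 1%R => constr:(@NCone K)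
  | 0%R => constr:(@NCzero K)
  | _ => let n := nc_index t env in constr:(@NCvar K n)
  end.

(* Reduces an equation in the (noncommutative) K-algebra B to identities
   between the coefficients of the words in its atoms. *)
Ltac nc_ring_coef K B :=
  rewrite ?expr2;
  lazymatch goal with
  | |- @eq _ ?l ?r =>
    let env := nc_atoms (@nil B) l in
    let env := nc_atoms env r in
    let el := nc_reify K env l in
    let er := nc_reify K env r in
    apply: (@nc_correct K B env el er);
    cbv [nc_norm nc_null nc_add nc_ins nc_mul nc_mul1 nc_scale nc_eqm nc_eqn nc_catm];
    do ?split
  end.

Tactic Notation "nc_ring" constr(K) constr(B) := nc_ring_coef K B; ring.
Tactic Notation "nc_field" constr(K) constr(B) := nc_ring_coef K B; field; try done.

(** * Real-valued norms and geometric limits *)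

Section RealNorm.
Variables (R : realType) (V : normedModType R[i]).

(** The norm is [R[i]]-valued; its real part gives access to suprema, square roots, [lra] and
    [nra]. *)
Definition rnorm (x : V) : R := complex.Re `|x|.

Lemma rnormE (x : V) : `|x| = (rnorm x)%:C.
Proof. by rewrite /rnorm RRe_real // normr_real. Qed.

Lemma rnorm_le (x : V) c : (rnorm x <= c) = (`|x| <= c%:C).
Proof. by rewrite rnormE lecR. Qed.

Lemma rnorm_lt (x : V) c : (rnorm x < c) = (`|x| < c%:C).
Proof. by rewrite rnormE ltcR. Qed.

Lemma rnorm_ge0 (x : V) : 0 <= rnorm x.
Proof. by rewrite -lecR -rnormE normr_ge0. Qed.

Lemma rnorm0 : rnorm (0 : V) = 0.
Proof. by rewrite /rnorm normr0. Qed.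

Lemma rnorm0_eq0 (x : V) : rnorm x = 0 -> x = 0.
Proof. by move=> x0; apply/normr0_eq0; rewrite rnormE x0. Qed.

Lemma rnormD (x y : V) : rnorm (x + y) <= rnorm x + rnorm y.
Proof. by rewrite rnorm_le rmorphD /= -!rnormE ler_normD. Qed.

Lemma rnormN (x : V) : rnorm (- x) = rnorm x.
Proof. by rewrite /rnorm normrN. Qed.

Lemma rnormB (x y : V) : rnorm (x - y) <= rnorm x + rnorm y.
Proof. by rewrite -(rnormN y) rnormD. Qed.

End RealNorm.

Lemma rnormZ (R : realType) (V : normedModType R[i]) (k : R[i]) (x : V) :
  rnorm (k *: x) = rnorm (k : R[i]^o) * rnorm x.
Proof. by apply: complexI; rewrite rmorphM /= -!rnormE normrZ. Qed.

Section ScalarNorm.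
Variable R : realType.
Implicit Types k l : R[i]^o.

Lemma rnormM k l : rnorm (k * l : R[i]^o) = rnorm k * rnorm l.
Proof. exact: rnormZ. Qed.

Lemma rnorm1 : rnorm (1 : R[i]^o) = 1.
Proof. by rewrite /rnorm normr1. Qed.

Lemma rnorm_real (c : R) : rnorm (c%:C : R[i]^o) = `|c|.
Proof. by rewrite /rnorm normc_def /= expr0n addr0 sqrtr_sqr. Qed.

Lemma rnorm_i : rnorm ('i : R[i]^o) = 1.
Proof. by rewrite /rnorm normc_def /= expr0n add0r expr1n sqrtr1. Qed.

Lemma rnorm_conj k : rnorm (k^* : R[i]^o) = rnorm k.
Proof. by case: k => a b; rewrite /rnorm !normc_def /= sqrrN. Qed.

Lemma rnorm_conjM k : rnorm (k^* * k : R[i]^o) = rnorm k ^+ 2.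
Proof. by rewrite rnormM rnorm_conj expr2. Qed.

Lemma abs_Re_le k : `|complex.Re k| <= rnorm k.
Proof.
case: k => a b; rewrite /rnorm normc_def /= -sqrtr_sqr ler_sqrt ?lerDl ?sqr_ge0 //.
by rewrite addr_ge0 ?sqr_ge0.
Qed.

Lemma abs_Im_le k : `|complex.Im k| <= rnorm k.
Proof.
case: k => a b; rewrite /rnorm normc_def /= -sqrtr_sqr ler_sqrt ?lerDr ?sqr_ge0 //.
by rewrite addr_ge0 ?sqr_ge0.
Qed.

Lemma rnorm_le_ReIm k : rnorm k <= `|complex.Re k| + `|complex.Im k|.
Proof.
rewrite [in leLHS](complexE k).
apply: le_trans (rnormD (_ : R[i]^o) _) _.
by rewrite rnorm_real rnormM rnorm_i rnorm_real mul1r.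
Qed.

End ScalarNorm.

Section GeometricLimit.
Variable R : realType.

(** Stated for a bare subadditive [nm], to serve both [rnorm] and the absolute value of [R]. The
    induction carries the exact geometric partial sum. *)
Lemma geo_dist (V : zmodType) (nm : V -> R) (q K : R) (x : nat -> V) :
  (forall a b, nm (a + b) <= nm a + nm b) -> nm 0 = 0 ->
  0 <= q < 1 -> 0 <= K ->
  (forall n, nm (x n.+1 - x n) <= K * q ^+ n) ->
  forall n m, nm (x (n + m)%N - x n) <= K * q ^+ n / (1 - q).
Proof.
move=> nmD nm0 /andP[q0 q1] K0 xS n m; have q1' : 1 - q != 0 by lra.
have : nm (x (n + m)%N - x n) <= K * q ^+ n * (1 - q ^+ m) / (1 - q).
  elim: m => [|m IH]; first by rewrite addn0 subrr nm0 expr0 subrr mulr0 mul0r.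
  rewrite addnS -(subrKA (x (n + m)%N)); apply: le_trans (nmD _ _) _.
  apply: le_trans (lerD (xS _) IH) _.
  by rewrite exprD exprS le_eqVlt; apply/orP; left; apply/eqP; field.
move=> /le_trans; apply; rewrite ler_pM2r ?invr_gt0 ?subr_gt0 //.
rewrite ler_piMr ?mulr_ge0 ?exprn_ge0 // gerBl exprn_ge0 //.
Qed.

Lemma geo_small (q K e : R) : 0 <= q < 1 -> 0 < e ->
  exists N, forall n, (N <= n)%N -> K * q ^+ n < e.
Proof.
move=> /andP[q0 q1] e0; have : K * q ^+ n @[n --> \oo] --> K * 0.
  by apply: cvgM; [apply: cvg_cst|apply: cvg_expr; rewrite ger0_norm].
rewrite mulr0 => /cvgrPdist_lt /(_ _ e0) [N _ NP]; exists N => n Nn.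
have := NP n Nn; rewrite /= sub0r normrN; apply: le_lt_trans; exact: ler_norm.
Qed.

Lemma geo_limit (V : completeNormedModType R[i]) (q K : R) (x : nat -> V) :
  0 <= q < 1 -> 0 <= K ->
  (forall n, rnorm (x n.+1 - x n) <= K * q ^+ n) ->
  exists y, forall n, rnorm (y - x n) <= K * q ^+ n / (1 - q).
Proof.
move=> q01 K0 xS.
have D := geo_dist (@rnormD _ _) (@rnorm0 R V) q01 K0 xS.
have q1 : 0 < 1 - q by case/andP: q01; lra.
have : cauchy (x n @[n --> \oo]).
  apply/cauchyP => e /= e0.
  have e_real : e = (complex.Re e)%:C by rewrite RRe_real // gtr0_real.
  have e0' : 0 < complex.Re e by rewrite e_real ltcR in e0.
  have [N NP] := geo_small (K / (1 - q)) q01 e0'.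
  exists (x N); exists N => //= n Nn; rewrite -ball_normE /= e_real -rnorm_lt.
  rewrite -rnormN opprB -(subnKC Nn); apply: le_lt_trans (D _ _) _.
  by rewrite mulrAC; apply: NP.
move=> /cauchy_cvg/cvg_ex[y xy]; exists y => n; apply/ler_addgt0Pl => e e0.
move/cvgrPdist_lt: xy => /(_ e%:C); rewrite ltcR => /(_ e0)[N _ NP].
have := NP (n + N)%N (leq_addl _ _); rewrite /= -rnorm_lt => yx.
rewrite -(subrKA (x (n + N)%N)); apply: le_trans (rnormD _ _) _.
by apply: lerD (D _ _); apply: ltW.
Qed.

Lemma geo_limitR (q K : R) (x : nat -> R) : 0 <= q < 1 -> 0 <= K ->
  (forall n, `|x n.+1 - x n| <= K * q ^+ n) ->
  exists y, forall n, `|y - x n| <= K * q ^+ n / (1 - q).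
Proof.
move=> q01 K0 xS.
have D := geo_dist (@ler_normD R R) (@normr0 R R) q01 K0 xS.
have q1 : 0 < 1 - q by case/andP: q01; lra.
have : cauchy (x n @[n --> \oo]).
  apply/cauchyP => e /= e0.
  have [N NP] := geo_small (K / (1 - q)) q01 e0.
  exists (x N); exists N => //= n Nn; rewrite -ball_normE /= distrC -(subnKC Nn).
  by apply: le_lt_trans (D _ _) _; rewrite mulrAC; apply: NP.
move=> /cauchy_cvg/cvg_ex[y xy]; exists y => n; apply/ler_addgt0Pl => e e0.
move/cvgrPdist_lt: xy => /(_ e e0)[N _ NP].
have yx := NP (n + N)%N (leq_addl _ _).
rewrite -(subrKA (x (n + N)%N)); apply: le_trans (ler_normD _ _) _.
by apply: lerD (D _ _); apply: ltW.
Qed.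

(** Real and imaginary parts converge separately, which accounts for the factor 2. *)
Lemma geo_limitC (q K : R) (x : nat -> R[i]^o) : 0 <= q < 1 -> 0 <= K ->
  (forall n, rnorm (x n.+1 - x n) <= K * q ^+ n) ->
  exists y, forall n, rnorm (y - x n) <= (K * q ^+ n / (1 - q)) *+ 2.
Proof.
move=> q01 K0 xS.
have [a aP] : exists a, forall n, `|a - complex.Re (x n)| <= K * q ^+ n / (1 - q).
  apply: geo_limitR => // n; apply: le_trans (xS n).
  by apply: le_trans (abs_Re_le _); case: (x n.+1) (x n) => [? ?] [? ?].
have [b bP] : exists b, forall n, `|b - complex.Im (x n)| <= K * q ^+ n / (1 - q).
  apply: geo_limitR => // n; apply: le_trans (xS n).
  by apply: le_trans (abs_Im_le _); case: (x n.+1) (x n) => [? ?] [? ?].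
exists (a +i* b) => n; apply: le_trans (rnorm_le_ReIm _) _.
by rewrite mulr2n; have := lerD (aP n) (bP n); case: (x n) => [? ?].
Qed.

End GeometricLimit.

(** * The unitization and its C*-norm *)

Section CStarNorm.
Variables (R : realType) (A : cstarAlgType R).
Implicit Types x y : A.

Lemma rnorm_cmul x y : rnorm (cmul x y) <= rnorm x * rnorm y.
Proof. by rewrite rnorm_le rmorphM /= -!rnormE cnormM. Qed.

Lemma rnorm_cstar x : rnorm (cmul (cadj x) x) = rnorm x ^+ 2.
Proof. by apply: complexI; rewrite rmorphXn /= -!rnormE cnorm_cstar. Qed.

Lemma rnorm_cadj x : rnorm (cadj x) = rnorm x.
Proof.
have le y : rnorm y <= rnorm (cadj y).
  have [->|y0] := eqVneq y 0; first by rewrite cadj0.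
  have y_gt0 : 0 < rnorm y.
    rewrite lt_neqAle rnorm_ge0 andbT eq_sym.
    by apply: contra_neq y0 => /rnorm0_eq0.
  by rewrite -(ler_pM2r y_gt0) -expr2 -rnorm_cstar rnorm_cmul.
by apply/eqP; rewrite eq_le le andbT -[in leRHS](cadjK x) le.
Qed.

(* [isCStarAlgebra] uses [Num.conj] and [unitization_adj] uses [conjc]; the two
   are convertible. *)
Lemma cadj_conjc (k : R[i]) x : cadj (k *: x) = conjc k *: cadj x.
Proof. exact: cadjZ. Qed.

End CStarNorm.

(* The scalars of the unitization are restricted to the reals; the imaginary
   unit reappears as the central element [uI]. *)
Definition unitiz (R : realType) (A : cstarAlgType R) : Type := A * R[i]^o.

Section UnitizationRing.
Variables (R : realType) (A : cstarAlgType R).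
Local Notation B := (unitiz A).

HB.instance Definition _ := GRing.Zmodule.copy B (A * R[i]^o)%type.

Implicit Types b c d : B.

Definition umul b c : B := unitization_mul b c.
Definition uone : B := (0, 1).
Definition uscale (k : R) b : B := (k%:C *: b.1, k%:C * b.2).

Lemma unitiz_eq b c : b.1 = c.1 -> b.2 = c.2 -> b = c.
Proof. by case: b c => [x k] [y l] /= -> ->. Qed.

Lemma umulA : associative umul.
Proof.
move=> [x k] [y l] [z m]; rewrite /umul /unitization_mul /=; apply: unitiz_eq; last exact: mulrA.
rewrite !cmulDl !cmulDr !scalerDr !scalerA !cmulZl !cmulZr !cmulA.
by rewrite [LHS](AC (4*3) (1*3*5*(2*4*6)*7))%AC /= [m * l]mulrC [m * k]mulrC.
Qed.

Lemma umul1 : left_id uone umul.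
Proof.
by move=> [x k]; rewrite /umul /unitization_mul /= cmul0l scaler0 addr0 add0r scale1r mul1r.
Qed.

Lemma umul1r : right_id uone umul.
Proof.
by move=> [x k]; rewrite /umul /unitization_mul /= cmul0r scaler0 addr0 add0r scale1r mulr1.
Qed.

Lemma umulDl : left_distributive umul +%R.
Proof.
move=> [x k] [y l] [z m]; rewrite /umul /unitization_mul /=; apply: unitiz_eq; last exact: mulrDl.
by rewrite /= cmulDl scalerDr scalerDl [LHS](AC (2*2*2) (1*3*5*(2*4*6)))%AC.
Qed.

Lemma umulDr : right_distributive umul +%R.
Proof.
move=> [x k] [y l] [z m]; rewrite /umul /unitization_mul /=; apply: unitiz_eq; last exact: mulrDr.
by rewrite /= cmulDr scalerDr scalerDl [LHS](AC (2*2*2) (1*3*5*(2*4*6)))%AC.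
Qed.

Lemma uone_neq0 : uone != 0.
Proof. by rewrite /uone; apply/eqP => -[] /eqP; rewrite oner_eq0. Qed.

HB.instance Definition _ := GRing.Zmodule_isNzRing.Build B
  umulA umul1 umul1r umulDl umulDr uone_neq0.

Lemma uscaleA (k l : R) b : uscale k (uscale l b) = uscale (k * l) b.
Proof. by rewrite /uscale /= rmorphM /= scalerA mulrA. Qed.

Lemma uscale1 : left_id 1 uscale.
Proof. by move=> [x k]; rewrite /uscale /= scale1r mul1r. Qed.

Lemma uscaleDr : right_distributive uscale +%R.
Proof. by move=> k [x l] [y m]; rewrite /uscale /= scalerDr mulrDr. Qed.

Lemma uscaleDl b : {morph uscale^~ b : k l / k + l}.
Proof. by move=> k l; rewrite /uscale rmorphD /= scalerDl mulrDl. Qed.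

HB.instance Definition _ := GRing.Zmodule_isLmodule.Build R B
  uscaleA uscale1 uscaleDr uscaleDl.

Lemma uscaleAl (k : R) b c : k *: (b * c) = (k *: b) * c.
Proof.
case: b c => [x l] [y m]; apply: unitiz_eq => /=; last exact: mulrA.
by rewrite cmulZl !scalerDr !scalerA [m * _]mulrC.
Qed.

Lemma uscaleAr (k : R) b c : k *: (b * c) = b * (k *: c).
Proof.
case: b c => [x l] [y m]; apply: unitiz_eq => /=; last exact: mulrCA.
by rewrite cmulZr !scalerDr !scalerA [l * _]mulrC.
Qed.

HB.instance Definition _ := GRing.Lmodule_isLalgebra.Build R B uscaleAl.
HB.instance Definition _ := GRing.Lalgebra_isAlgebra.Build R B uscaleAr.

Definition uadj b : B := unitization_adj b.

Lemma uadjD : {morph uadj : b c / b + c}.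
Proof. by move=> [x k] [y l]; apply: unitiz_eq => /=; rewrite ?cadjD ?rmorphD. Qed.

Lemma uadjM b c : uadj (b * c) = uadj c * uadj b.
Proof.
case: b c => [x k] [y l]; apply: unitiz_eq => /=; last by rewrite rmorphM mulrC.
by rewrite !cadjD cadjM !cadj_conjc -!addrA [k^* *: _ + _]addrC.
Qed.

Lemma uadjZ (k : R) b : uadj (k *: b) = k *: uadj b.
Proof.
case: b => [x l]; apply: unitiz_eq => /=; first by rewrite cadj_conjc conjc_real.
by rewrite rmorphM; congr (_ * _); exact: conjc_real.
Qed.

Lemma uadjK : involutive uadj.
Proof. by move=> [x k]; rewrite /uadj /unitization_adj /= cadjK conjcK. Qed.

Lemma uadjN b : uadj (- b) = - uadj b.
Proof. by rewrite -scaleN1r uadjZ scaleN1r. Qed.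

Lemma uadjB b c : uadj (b - c) = uadj b - uadj c.
Proof. by rewrite uadjD uadjN. Qed.

Lemma uadj0 : uadj 0 = 0.
Proof. by rewrite -(scale0r (0 : B)) uadjZ !scale0r. Qed.

Lemma uadj1 : uadj 1 = 1.
Proof. by apply: unitiz_eq; [exact: cadj0|exact: conjc1]. Qed.

Definition uI : B := (0, 'i).

Lemma uIC b : uI * b = b * uI.
Proof.
case: b => x k; apply: unitiz_eq => /=; last exact: mulrC.
by rewrite cmul0l cmul0r scaler0 !add0r addr0.
Qed.

Lemma uII : uI * uI = -1.
Proof.
apply: unitiz_eq => /=; last by rewrite -expr2 sqr_i.
by rewrite cmul0l scaler0 !addr0 oppr0.
Qed.

Lemma uadjI : uadj uI = - uI.
Proof.
by apply: unitiz_eq; rewrite /= ?cadj0 ?oppr0 //; apply/eqP; rewrite eq_complex /= oppr0 !eqxx.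
Qed.

Definition inA (x : A) : B := (x, 0).
Definition in_ideal b := b.2 = 0 :> R[i].

Lemma inA_D x y : inA (x + y) = inA x + inA y.
Proof. by apply: unitiz_eq => //=; rewrite addr0. Qed.

Lemma inA_M x y : inA (cmul x y) = inA x * inA y.
Proof. by apply: unitiz_eq => /=; rewrite ?scale0r ?addr0 ?mulr0. Qed.

Lemma inA_adj x : inA (cadj x) = uadj (inA x).
Proof. by apply: unitiz_eq => //; apply/esym/conjc0. Qed.

Lemma inA_inj : injective inA.
Proof. by move=> x y []. Qed.

Lemma in_idealP b : in_ideal b -> b = inA b.1.
Proof. by case: b => x k; rewrite /in_ideal /inA /= => ->. Qed.

Lemma in_idealM b c : in_ideal b -> in_ideal (b * c) /\ in_ideal (c * b).
Proof. by rewrite /in_ideal /= => ->; rewrite mul0r mulr0. Qed.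

Lemma in_idealD b c : in_ideal b -> in_ideal c -> in_ideal (b + c).
Proof. by rewrite /in_ideal /= => -> ->; rewrite addr0. Qed.

End UnitizationRing.

Section UnitizationNorm.
Variables (R : realType) (A : cstarAlgType R).
Local Notation B := (unitiz A).
Implicit Types (b c : B) (x y : A).

Definition uact b x : A := cmul b.1 x + b.2 *: x.

Lemma uactM b c x : uact (b * c) x = uact b (uact c x).
Proof.
case: b c => [y k] [z l]; rewrite /uact /= !cmulDl !cmulDr !cmulA !cmulZl !cmulZr.
by rewrite scalerDr scalerA -!addrA.
Qed.

Lemma uactD b c x : uact (b + c) x = uact b x + uact c x.
Proof.
by rewrite /uact /= cmulDl scalerDl -!addrA; congr (_ + _); rewrite addrCA.
Qed.

Lemma uactZ b (k : R[i]) x : uact b (k *: x) = k *: uact b x.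
Proof. by rewrite /uact cmulZr scalerDr !scalerA mulrC. Qed.

Lemma uact_scale b (k : R) x : uact (k *: b) x = k%:C *: uact b x.
Proof. by rewrite /uact /= cmulZl scalerDr scalerA. Qed.

(** For the [A]-valued inner product [cmul (cadj x) y], the adjoint of the action of [b] is the
    action of [uadj b]; the C*-inequality for [unorm] rests on this. *)
Lemma cmul_uact b x y : cmul (cadj (uact b x)) y = cmul (cadj x) (uact (uadj b) y).
Proof.
by rewrite /uact cadjD cmulDl cmulDr cadjM cadj_conjc cmulZl cmulZr cmulA.
Qed.

(* The operator norm of the left multiplication by [b] on [A] is only a
   C*-seminorm when [A] is unital; the scalar part makes it definite. *)
Definition unorm_set b : set R :=
  [set rnorm (b.2 : R[i]^o)] `|` [set rnorm (uact b x) | x in [set x : A | rnorm x <= 1]].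

Definition unorm b : R := sup (unorm_set b).

Lemma unorm_set_ub b : ubound (unorm_set b) (rnorm b.1 + rnorm (b.2 : R[i]^o)).
Proof.
move=> r [->|[x /= x1 <-]]; first by rewrite lerDr rnorm_ge0.
apply: le_trans (rnormD _ _) _; rewrite rnormZ.
apply: lerD; last by rewrite ler_piMr ?rnorm_ge0.
by apply: le_trans (rnorm_cmul _ _) _; rewrite ler_piMr ?rnorm_ge0.
Qed.

Lemma unorm_has_sup b : has_sup (unorm_set b).
Proof.
split; first by exists (rnorm (b.2 : R[i]^o)); left.
by exists (rnorm b.1 + rnorm (b.2 : R[i]^o)); exact: unorm_set_ub.
Qed.

Lemma unorm_le_sum b : unorm b <= rnorm b.1 + rnorm (b.2 : R[i]^o).
Proof. by apply: ge_sup; [case: (unorm_has_sup b)|exact: unorm_set_ub]. Qed.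

Lemma rnorm2_le b : rnorm (b.2 : R[i]^o) <= unorm b.
Proof. by apply: ub_le_sup; [case: (unorm_has_sup b)|left]. Qed.

Lemma unorm_ge0 b : 0 <= unorm b.
Proof. exact: le_trans (rnorm_ge0 _) (rnorm2_le b). Qed.

Lemma rnorm_uact b x : rnorm (uact b x) <= unorm b * rnorm x.
Proof.
have [->|x0] := eqVneq x 0.
  by rewrite /uact cmul0r scaler0 addr0 rnorm0 mulr0.
have x_gt0 : 0 < rnorm x.
  rewrite lt_neqAle rnorm_ge0 andbT eq_sym.
  by apply: contra_neq x0 => /rnorm0_eq0.
rewrite -ler_pdivrMr // mulrC.
have E : rnorm (uact b ((rnorm x)^-1%:C *: x)) = (rnorm x)^-1 * rnorm (uact b x).
  by rewrite uactZ rnormZ rnorm_real ger0_norm // invr_ge0 ltW.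
rewrite -E; apply: ub_le_sup; first by case: (unorm_has_sup b).
right; exists ((rnorm x)^-1%:C *: x) => //=.
by rewrite rnormZ rnorm_real ger0_norm ?mulVf ?gt_eqF // invr_ge0 ltW.
Qed.

Lemma unorm_le b (c : R) : 0 <= c -> rnorm (b.2 : R[i]^o) <= c ->
  (forall x, rnorm (uact b x) <= c * rnorm x) -> unorm b <= c.
Proof.
move=> c0 kc bc; apply: ge_sup; first by case: (unorm_has_sup b).
move=> r [-> //|[x /= x1 <-]]; apply: le_trans (bc x) _.
by rewrite ler_piMr.
Qed.

(** Writing [b = x + k 1], the product [x x^*] equals [b x^* - k x^*], whose norm is at most
    [2 * unorm b * |x|]. Completeness of [unorm] is inherited through this bound. *)
Lemma rnorm1_le b : rnorm b.1 <= unorm b *+ 2.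
Proof.
have [x0|x0] := eqVneq b.1 0.
  by rewrite x0 rnorm0 mulrn_wge0 ?unorm_ge0.
have x_gt0 : 0 < rnorm b.1.
  rewrite lt_neqAle rnorm_ge0 andbT eq_sym.
  by apply: contra_neq x0 => /rnorm0_eq0.
have := rnorm_uact b (cadj b.1); rewrite rnorm_cadj => H.
rewrite -(ler_pM2r x_gt0) -expr2 -[X in X ^+ 2]rnorm_cadj -rnorm_cstar cadjK.
rewrite (_ : cmul b.1 _ = uact b (cadj b.1) - b.2 *: cadj b.1); last first.
  by rewrite /uact addrK.
apply: le_trans (rnormB _ _) _; rewrite mulrnAl mulr2n; apply: lerD H _.
by rewrite rnormZ rnorm_cadj ler_pM2r // rnorm2_le.
Qed.

Lemma unormD b c : unorm (b + c) <= unorm b + unorm c.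
Proof.
apply: unorm_le; first by rewrite addr_ge0 ?unorm_ge0.
  by apply: le_trans (rnormD _ _) _; apply: lerD; exact: rnorm2_le.
move=> x; rewrite uactD mulrDl; apply: le_trans (rnormD _ _) _.
by apply: lerD; exact: rnorm_uact.
Qed.

Lemma unormM b c : unorm (b * c) <= unorm b * unorm c.
Proof.
apply: unorm_le; first by rewrite mulr_ge0 ?unorm_ge0.
  by rewrite /= rnormM ler_pM ?rnorm_ge0 ?rnorm2_le.
move=> x; rewrite uactM -mulrA; apply: le_trans (rnorm_uact _ _) _.
by rewrite ler_wpM2l ?unorm_ge0 ?rnorm_uact.
Qed.

Lemma unormZ_le (k : R) b : unorm (k *: b) <= `|k| * unorm b.
Proof.
apply: unorm_le; first by rewrite mulr_ge0 ?unorm_ge0.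
  by rewrite /= rnormM rnorm_real ler_wpM2l ?rnorm2_le.
by move=> x; rewrite uact_scale rnormZ rnorm_real -mulrA ler_wpM2l ?rnorm_uact.
Qed.

Lemma unorm0 : unorm 0 = 0.
Proof.
apply/eqP; rewrite eq_le unorm_ge0 andbT.
by rewrite -(scale0r 0); apply: le_trans (unormZ_le _ _) _; rewrite normr0 mul0r.
Qed.

Lemma unormZ (k : R) b : unorm (k *: b) = `|k| * unorm b.
Proof.
have [->|k0] := eqVneq k 0; first by rewrite scale0r unorm0 normr0 mul0r.
apply/eqP; rewrite eq_le unormZ_le /=.
have := unormZ_le k^-1 (k *: b); rewrite scalerA mulVf // scale1r normfV.
by rewrite ler_pdivlMl ?normr_gt0.
Qed.

Lemma unormN b : unorm (- b) = unorm b.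
Proof. by rewrite -scaleN1r unormZ normrN normr1 mul1r. Qed.

Lemma unormB b c : unorm (b - c) <= unorm b + unorm c.
Proof. by rewrite -(unormN c) unormD. Qed.

Lemma unorm0_eq0 b : unorm b = 0 -> b = 0.
Proof.
move=> b0; have := rnorm1_le b; have := rnorm2_le b; rewrite b0 mul0rn.
case: b {b0} => x k /= k0 x0; apply: unitiz_eq; apply: rnorm0_eq0; apply/eqP.
  by rewrite eq_le x0 rnorm_ge0.
by rewrite eq_le k0 rnorm_ge0.
Qed.

Lemma unorm_cstar_le b : unorm b ^+ 2 <= unorm (uadj b * b).
Proof.
rewrite -[leRHS]sqr_sqrtr ?unorm_ge0 // ler_sqr ?nnegrE ?unorm_ge0 ?sqrtr_ge0 //.
apply: unorm_le; first exact: sqrtr_ge0.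
  rewrite -(@ler_pXn2r _ 2) ?nnegrE ?sqrtr_ge0 ?rnorm_ge0 // sqr_sqrtr ?unorm_ge0 //.
  by rewrite -rnorm_conjM; exact: (rnorm2_le (uadj b * b)).
move=> x; rewrite -(@ler_pXn2r _ 2) ?nnegrE ?mulr_ge0 ?sqrtr_ge0 ?rnorm_ge0 //.
rewrite exprMn sqr_sqrtr ?unorm_ge0 // -rnorm_cstar cmul_uact -uactM.
apply: le_trans (rnorm_cmul _ _) _; rewrite rnorm_cadj mulrC expr2 mulrA.
by rewrite ler_wpM2r ?rnorm_ge0 ?rnorm_uact.
Qed.

Lemma unorm_adj b : unorm (uadj b) = unorm b.
Proof.
have le c : unorm c <= unorm (uadj c).
  have [->|c0] := eqVneq c 0; first by rewrite uadj0.
  have c_gt0 : 0 < unorm c.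
    rewrite lt_neqAle unorm_ge0 andbT eq_sym.
    by apply: contra_neq c0 => /unorm0_eq0.
  rewrite -(ler_pM2r c_gt0) -expr2.
  exact: le_trans (unorm_cstar_le c) (unormM _ _).
by apply/eqP; rewrite eq_le le andbT -[in leRHS](uadjK b) le.
Qed.

Lemma unorm1 : unorm 1 <= 1.
Proof.
apply: unorm_le => //; first by rewrite rnorm1.
by move=> x; rewrite /uact cmul0l add0r scale1r mul1r.
Qed.

Lemma unorm_inA x : unorm (inA x) <= rnorm x.
Proof. by apply: le_trans (unorm_le_sum _) _; rewrite rnorm0 addr0. Qed.

Lemma unorm_limit (q K : R) (u : nat -> B) : 0 <= q < 1 -> 0 <= K ->
  (forall n, unorm (u n.+1 - u n) <= K * q ^+ n) ->
  exists b, forall e, 0 < e -> exists N, forall n, (N <= n)%N -> unorm (b - u n) < e.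
Proof.
move=> q01 K0 uS; have q1 : 0 < 1 - q by case/andP: q01; lra.
have [x xP] : exists x, forall n, rnorm (x - (u n).1) <= (K * 2) * q ^+ n / (1 - q).
  apply: geo_limit => // [|n]; first lra.
  apply: le_trans (rnorm1_le (u n.+1 - u n)) _; rewrite mulr2n.
  by have := uS n; lra.
have [k kP] : exists k : R[i]^o, forall n, rnorm (k - (u n).2) <= (K * q ^+ n / (1 - q)) *+ 2.
  by apply: geo_limitC => // n; apply: le_trans (uS n); exact: (rnorm2_le (u n.+1 - u n)).
(* 4 = 2 + 2: [rnorm1_le] doubles the bound on the algebra part, and [geo_limitC] the one on the
   scalar part. *)
exists (x, k) => e e0; have [N NP] := geo_small (K * 4 / (1 - q)) q01 e0.
exists N => n Nn; apply: le_lt_trans (NP n Nn); apply: le_trans (unorm_le_sum _) _.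
apply: le_trans (lerD (xP n) (kP n)) _; rewrite le_eqVlt; apply/orP; left; apply/eqP.
rewrite mulr2n; field; lra.
Qed.

End UnitizationNorm.

(** * Square roots and inverses *)

Section FunctionalCalculus.
Variables (R : realType) (A : cstarAlgType R).
Local Notation B := (unitiz A).
Implicit Types (b c h t u v w x y : B) (k : R).
Local Notation N := (@unorm R A).
Local Notation adj := (@uadj R A).

Definition unorm_closed (P : B -> Prop) :=
  forall b, (forall e, 0 < e -> exists2 c, P c & N (b - c) < e) -> P b.

Lemma unorm_closed_eq0 (f : B -> B) (L : R) :
  (forall b c, N (f b - f c) <= L * N (b - c)) -> unorm_closed (fun b => f b = 0).
Proof.
move=> fL b bP; apply: unorm0_eq0; apply/eqP; rewrite eq_le unorm_ge0 andbT.
apply/ler_addgt0Pl => e e0; rewrite addr0.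
have L1 : 0 < `|L| + 1 by rewrite ltr_wpDl.
have [c c0 bc] := bP (e / (`|L| + 1)) (divr_gt0 e0 L1).
have := fL b c; rewrite c0 subr0 => /le_trans; apply.
apply: le_trans (_ : (`|L| + 1) * N (b - c) <= _).
  rewrite ler_wpM2r ?unorm_ge0 //; apply: le_trans (ler_norm L) _; lra.
by rewrite mulrC -ler_pdivlMr // ltW.
Qed.

Lemma unorm_closed_ball (d : R) : unorm_closed (fun b => N b <= d).
Proof.
move=> b bP; apply/ler_addgt0Pl => e e0; have [c cd bc] := bP e e0.
rewrite -(subrK c b); apply: le_trans (unormD _ _) _.
by apply: lerD cd; exact: ltW.
Qed.

Lemma unorm_closed_comm c : unorm_closed (fun b => c * b = b * c).
Proof.
have H : unorm_closed (fun b => c * b - b * c = 0).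
  apply: (@unorm_closed_eq0 (fun b => c * b - b * c) (N c * 2)) => x y.
  have -> : c * x - x * c - (c * y - y * c) = c * (x - y) - (x - y) * c.
    by nc_ring R B.
  apply: le_trans (unormB _ _) _.
  by have := unormM c (x - y); have := unormM (x - y) c; lra.
move=> b bP; apply/eqP; rewrite -subr_eq0; apply/eqP; apply: H => e e0.
by have [x xP ?] := bP e e0; exists x => //; rewrite xP subrr.
Qed.

Lemma unorm_closed_sa : unorm_closed (fun b => adj b = b).
Proof.
have H : unorm_closed (fun b => adj b - b = 0).
  apply: (@unorm_closed_eq0 (fun b => adj b - b) 2) => x y.
  have -> : adj x - x - (adj y - y) = adj (x - y) - (x - y).
    by rewrite uadjB; nc_ring R B.
  by apply: le_trans (unormB _ _) _; rewrite unorm_adj; lra.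
move=> b bP; apply/eqP; rewrite -subr_eq0; apply/eqP; apply: H => e e0.
by have [x xP ?] := bP e e0; exists x => //; rewrite xP subrr.
Qed.

(** Banach's fixed point theorem on a ball, iterating from 0. The last clause transfers closed
    [F]-stable properties to the limit, such as self-adjointness and commutation with a given
    element. *)
Lemma unorm_fixed_point (F : B -> B) (q d : R) : 0 <= q < 1 -> 0 <= d ->
  (forall b, N b <= d -> N (F b) <= d) ->
  (forall b c, N b <= d -> N c <= d -> N (F b - F c) <= q * N (b - c)) ->
  exists x, [/\ F x = x, N x <= d & forall P : B -> Prop, unorm_closed P ->
    P 0 -> (forall b, P b -> P (F b)) -> P x].
Proof.
move=> q01 d0 Fd Fq; pose u n := iter n F 0.
have ud n : N (u n) <= d by elim: n => [|n IH] /=; rewrite ?unorm0 // Fd.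
have uS n : N (u n.+1 - u n) <= d * q ^+ n.
  elim: n => [|n IH]; first by rewrite subr0 expr0 mulr1; exact: (ud 1%N).
  apply: le_trans (Fq (u n.+1) (u n) (ud _) (ud _)) _.
  by rewrite exprS mulrCA ler_wpM2l //; case/andP: q01.
have [x xP] := unorm_limit q01 d0 uS.
have xlim P : unorm_closed P -> P 0 -> (forall b, P b -> P (F b)) -> P x.
  move=> Pcl P0 PF; apply: Pcl => e e0; have [n nP] := xP e e0.
  by exists (u n); [elim: (n) => //= k IH; apply: PF|apply: nP].
have xd : N x <= d.
  by apply: (xlim (fun b => N b <= d)); rewrite ?unorm0 //; exact: unorm_closed_ball.
exists x; split=> //; apply/eqP; rewrite -subr_eq0; apply/eqP/unorm0_eq0/eqP.
rewrite eq_le unorm_ge0 andbT; apply/ler_addgt0Pl => e e0; rewrite addr0.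
have [|n nP] := xP (e / 2); first by lra.
have E : F x - x = (F x - F (u n)) - (x - u n.+1) by rewrite /=; nc_ring R B.
rewrite E; apply: le_trans (unormB _ _) _.
have := Fq _ _ xd (ud n); have := nP n (leqnn n); have := nP n.+1 (leqnSn n).
have := unorm_ge0 (x - u n); case/andP: q01; nra.
Qed.

(** The equation [(1 - x)^2 = 1 - t] says that [x] is fixed by [b -> (t + b^2) / 2], which contracts
    the ball of radius [N t] by the factor [N t]. *)
Lemma sqrt_one_sub t : N t < 1 -> exists x,
  [/\ (1 - x) * (1 - x) = 1 - t, N x <= N t, adj t = t -> adj x = x &
      forall c, c * t = t * c -> c * x = x * c].
Proof.
move=> t1; have t0 := unorm_ge0 t.
have [||||x [xE xt xP]] := @unorm_fixed_point (fun b => 2^-1 *: (t + b * b)) (N t) (N t).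
- by rewrite t0.
- by [].
- move=> b bt; rewrite unormZ ger0_norm ?invr_ge0 //.
  have := unormD t (b * b); have := unormM b b; have := unorm_ge0 b; nra.
- move=> b c bt ct.
  have -> : 2^-1 *: (t + b * b) - 2^-1 *: (t + c * c) =
      2^-1 *: (b * (b - c) + (b - c) * c) by nc_ring R B.
  rewrite unormZ ger0_norm ?invr_ge0 //.
  have := unormD (b * (b - c)) ((b - c) * c).
  have := unormM b (b - c); have := unormM (b - c) c.
  have := unorm_ge0 (b - c); nra.
exists x; split=> // [|tsa|c ct].
- rewrite (_ : (1 - x) * (1 - x) = 1 - 2 *: x + x * x); last by nc_ring R B.
  by rewrite -{1}xE; nc_field R B.
- apply: (xP (fun b => adj b = b)); [exact: unorm_closed_sa|exact: uadj0|move=> b bsa].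
  by rewrite uadjZ uadjD uadjM tsa bsa.
- apply: (xP (fun b => c * b = b * c)); [exact: unorm_closed_comm|by rewrite mulr0 mul0r|move=> b cb].
  by rewrite -scalerAr -scalerAl mulrDr mulrDl ct mulrA cb -!mulrA cb.
Qed.

Lemma neumann t : N t < 1 -> exists y,
  [/\ (1 - t) * y = 1, y * (1 - t) = 1 & N y <= (1 - N t)^-1].
Proof.
move=> t1; have t0 := unorm_ge0 t.
have [||||y [yE yt yP]] := @unorm_fixed_point (fun b => 1 + t * b) (N t) (1 - N t)^-1.
- by rewrite t0.
- by rewrite invr_ge0; lra.
- move=> b bt; apply: le_trans (unormD _ _) _.
  have E : (1 - N t)^-1 = 1 + N t * (1 - N t)^-1 by field; lra.
  rewrite E; apply: lerD; first exact: unorm1.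
  by apply: le_trans (unormM _ _) _; rewrite ler_wpM2l.
- by move=> b c _ _; rewrite opprD addrACA subrr add0r -mulrBr unormM.
have yt' : t * y = y * t.
  apply: (yP (fun b => t * b = b * t)); [exact: unorm_closed_comm|by rewrite mulr0 mul0r|move=> b tb].
  by rewrite mulrDr mulrDl mulr1 mul1r {1}tb mulrA.
have E : (1 - t) * y = 1 by rewrite mulrBl mul1r -{1}yE addrK.
by exists y; split=> //; rewrite -[RHS]E mulrBr mulrBl mulr1 mul1r yt'.
Qed.

(* For self-adjoint h this says [h >= k]. *)
Definition upos (k : R) h := exists C, N (C%:A - h) <= C - k.

Lemma upos_const k : upos k k%:A.
Proof. by exists k; rewrite !subrr unorm0. Qed.

Lemma uposD k1 k2 h1 h2 : upos k1 h1 -> upos k2 h2 -> upos (k1 + k2) (h1 + h2).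
Proof.
move=> [C1 H1] [C2 H2]; exists (C1 + C2).
have -> : (C1 + C2)%:A - (h1 + h2) = (C1%:A - h1) + (C2%:A - h2) by nc_ring R B.
by apply: le_trans (unormD _ _) _; lra.
Qed.

Lemma upos_perturb k h d e : upos k h -> N d <= e -> upos (k - e) (h + d).
Proof.
move=> [C H] de; exists C; rewrite opprD addrA.
by apply: le_trans (unormB _ _) _; lra.
Qed.

(** [h] is [C (1 - t)] with [N t <= 1 - k / C < 1], so [neumann] inverts it. *)
Lemma upos_inv k h : 0 < k -> upos k h ->
  exists h', [/\ h * h' = 1, h' * h = 1 & N h' <= k^-1].
Proof.
move=> k0 [C HC]; have C0 : 0 < C by have := unorm_ge0 (C%:A - h); lra.
have Cn0 : C != 0 by rewrite gt_eqF.
pose t := C^-1 *: (C%:A - h).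
have tN : N t <= 1 - k / C.
  rewrite unormZ ger0_norm ?invr_ge0 ?(ltW C0) // [leLHS]mulrC ler_pdivrMr //.
  by rewrite mulrBl divfK // mul1r.
have kC : 0 < k / C by rewrite divr_gt0.
have [|y [ty yt yN]] := @neumann t; first by lra.
have E : h = C *: (1 - t) by rewrite /t; nc_field R B.
exists (C^-1 *: y); split.
- by rewrite E -scalerAl -scalerAr scalerA mulfV // ty scale1r.
- by rewrite E -scalerAl -scalerAr scalerA mulVf // yt scale1r.
rewrite unormZ ger0_norm ?invr_ge0 ?(ltW C0) //.
apply: le_trans (_ : C^-1 * (k / C)^-1 <= _).
  rewrite ler_wpM2l ?invr_ge0 ?(ltW C0) //; apply: le_trans yN _.
  by rewrite lef_pV2 ?posrE //; lra.
by rewrite invf_div mulKf.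
Qed.

Lemma upos_sqrt k h : 0 < k -> upos k h -> adj h = h ->
  exists w, [/\ adj w = w, w * w = h, exists2 l, 0 < l & upos l w &
    forall c, c * h = h * c -> c * w = w * c].
Proof.
move=> k0 [C HC] hsa; have C0 : 0 < C by have := unorm_ge0 (C%:A - h); lra.
have Cn0 : C != 0 by rewrite gt_eqF.
pose t := C^-1 *: (C%:A - h).
have kC : 0 < k / C by rewrite divr_gt0.
have t1 : N t < 1.
  apply: le_lt_trans (_ : 1 - k / C < 1); last by lra.
  rewrite unormZ ger0_norm ?invr_ge0 ?(ltW C0) // [leLHS]mulrC ler_pdivrMr //.
  by rewrite mulrBl divfK // mul1r.
have [x [xx xt xsa xc]] := sqrt_one_sub t1.
have tsa : adj t = t by rewrite uadjZ uadjB uadjZ uadj1 hsa.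
have S0 : 0 < Num.sqrt C by rewrite sqrtr_gt0.
have SS : Num.sqrt C * Num.sqrt C = C by rewrite -expr2 sqr_sqrtr // ltW.
exists (Num.sqrt C *: (1 - x)); split.
- by rewrite uadjZ uadjB uadj1 xsa.
- rewrite -scalerAl -scalerAr scalerA SS xx /t; nc_field R B.
- exists (Num.sqrt C * (1 - N x)); first by rewrite mulr_gt0 //; lra.
  exists (Num.sqrt C).
  have -> : (Num.sqrt C)%:A - Num.sqrt C *: (1 - x) = Num.sqrt C *: x by nc_ring R B.
  by rewrite unormZ ger0_norm ?(ltW S0) //; lra.
move=> c ch; have ct : c * t = t * c.
  by rewrite /t -scalerAr -scalerAl mulrBr mulrBl ch -scalerAr -scalerAl mulr1 mul1r.
by rewrite -scalerAr -scalerAl mulrBr mulrBl mulr1 mul1r xc.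
Qed.

Lemma unorm_le_sqrt u m : N (adj u * u) <= m -> N u <= Num.sqrt m.
Proof.
move=> um; have m0 : 0 <= m := le_trans (unorm_ge0 _) um.
rewrite -(@ler_pXn2r _ 2) ?nnegrE ?sqrtr_ge0 ?unorm_ge0 // sqr_sqrtr //.
exact: le_trans (unorm_cstar_le _) um.
Qed.

(* For commuting self-adjoint x and y, [x ^+ 2 + y ^+ 2] is [adj u * u] for
   [u = x + i y], and x and y are the real and imaginary parts of u. *)
Lemma unorm_commuting_squares x y (m : R) : adj x = x -> adj y = y -> x * y = y * x ->
  N (x * x + y * y) <= m -> N x <= Num.sqrt m /\ N y <= Num.sqrt m.
Proof.
move=> xsa ysa xy xym; pose I := uI A.
have H z w : adj z = z -> adj w = w -> z * w = w * z -> N (z * z + w * w) <= m ->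
    N z <= Num.sqrt m.
  move=> zsa wsa zw zwm; pose u := z + I * w.
  have uE : adj u = z - I * w.
    by rewrite uadjD uadjM uadjI zsa wsa mulrN -uIC.
  have uu : adj u * u = z * z + w * w.
    rewrite uE mulrDr !mulrBl -!mulrA [w * (I * w)]mulrA -(uIC w) -[I * w * w]mulrA.
    rewrite (mulrA I I) uII mulN1r opprK [z * (I * w)]mulrA -(uIC z) -mulrA zw.
    by nc_ring R B.
  have uN : N u <= Num.sqrt m by apply: unorm_le_sqrt; rewrite uu.
  have -> : z = 2^-1 *: (u + adj u) by rewrite uE /u; nc_field R B.
  rewrite unormZ ger0_norm ?invr_ge0 //.
  by have := unormD u (adj u); rewrite unorm_adj; lra.
by split; [apply: (H x y)|apply: (H y x) => //; rewrite addrC].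
Qed.

(** The iteration alone does not bound [w] by 1; the relation [w^2 + b^2 = 1] between commuting
    self-adjoint elements does. *)
Lemma sqrt_one_sub_square b : adj b = b -> N b < 1 -> exists w,
  [/\ adj w = w, w * w = 1 - b * b, N w <= 1 & forall c, c * b = b * c -> c * w = w * c].
Proof.
move=> bsa b1; have b0 := unorm_ge0 b.
have [|x [xx _ xsa xc]] := @sqrt_one_sub (b * b).
  by have := unormM b b; nra.
have wsa : adj (1 - x) = 1 - x by rewrite uadjB uadj1 xsa // uadjM bsa.
have wc c : c * b = b * c -> c * (1 - x) = (1 - x) * c.
  by move=> cb; rewrite mulrBr mulrBl mulr1 mul1r xc // mulrA cb -mulrA cb mulrA.
exists (1 - x); split=> //; have [||||+ _] := @unorm_commuting_squares (1 - x) b 1 => //.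
- by rewrite wc.
- by rewrite xx subrK unorm1.
by rewrite sqrtr1.
Qed.

(** For [M > N b], the difference [M^2 - b^2] is [M^2 w^2] with [N w <= 1], hence of norm at most
    [M^2]. *)
Lemma square_upos b : adj b = b -> upos 0 (b * b).
Proof.
move=> bsa; have b0 := unorm_ge0 b; pose M := N b + 1.
have M0 : 0 < M by rewrite /M; lra.
have Mn0 : M != 0 by rewrite gt_eqF.
have [||w [_ ww w1 _]] := @sqrt_one_sub_square (M^-1 *: b).
- by rewrite uadjZ bsa.
- by rewrite unormZ ger0_norm ?invr_ge0 ?(ltW M0) // [ltLHS]mulrC ltr_pdivrMr // mul1r /M; lra.
exists (M * M); rewrite subr0.
have -> : (M * M)%:A - b * b = (M * M) *: (w * w) by rewrite ww; nc_field R B.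
rewrite unormZ ger0_norm ?mulr_ge0 ?(ltW M0) // ler_piMr ?mulr_ge0 ?(ltW M0) //.
by have := unormM w w; have := unorm_ge0 w; nra.
Qed.

Lemma unit_adj b b' : adj b = b -> b * b' = 1 -> b' * b = 1 -> adj b' = b'.
Proof.
move=> bsa bb' b'b; rewrite -[RHS]mul1r -(uadj1 A) -bb' uadjM bsa -mulrA bb'.
by rewrite mulr1.
Qed.

Lemma unit_comm b b' c : b * b' = 1 -> b' * b = 1 -> c * b = b * c -> c * b' = b' * c.
Proof.
move=> bb' b'b cb; rewrite -[LHS]mul1r -b'b -mulrA (mulrA b) -cb -(mulrA c) bb'.
by rewrite mulr1.
Qed.

(** For [M > N b'], [b^2 - M^-2 = b (1 - (b' / M)^2) b] is the square of [b d], where [d] is the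
    root of the middle factor. *)
Lemma unit_square_upos b b' : adj b = b -> b * b' = 1 -> b' * b = 1 ->
  exists2 k, 0 < k & upos k (b * b).
Proof.
move=> bsa bb' b'b; have b'sa := unit_adj bsa bb' b'b.
pose M := N b' + 1; have b'0 := unorm_ge0 b'; have M0 : 0 < M by rewrite /M; lra.
have Mn0 : M != 0 by rewrite gt_eqF.
have [||d [dsa dd d1 dc]] := @sqrt_one_sub_square (M^-1 *: b').
- by rewrite uadjZ b'sa.
- by rewrite unormZ ger0_norm ?invr_ge0 ?(ltW M0) // [ltLHS]mulrC ltr_pdivrMr // mul1r /M; lra.
have bd : b * d = d * b by rewrite dc // -scalerAr -scalerAl bb' b'b.
have [|C HC] := @square_upos (b * d); first by rewrite uadjM dsa bsa bd.
have E : b * b = b * d * (b * d) + (M^-1 * M^-1)%:A.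
  rewrite {2}bd -!mulrA (mulrA d d) dd !mulrA.
  rewrite (_ : b * (1 - M^-1 *: b' * (M^-1 *: b')) * b =
    b * b - (M^-1 * M^-1) *: ((b * b') * (b' * b))); last by nc_ring R B.
  by rewrite bb' b'b mulr1 subrK.
exists (M^-1 * M^-1); first by rewrite mulr_gt0 ?invr_gt0.
rewrite -[X in upos X]add0r E; apply: uposD; last exact: upos_const.
by exists C.
Qed.

(** * Projections and calculus in their corners *)

Definition uproj e := adj e = e /\ e * e = e.

Lemma uproj_norm e : uproj e -> N e <= 1.
Proof.
move=> [esa ee]; have := unorm_cstar_le e; rewrite esa ee.
by have := unorm_ge0 e; nra.
Qed.

Lemma unorm_uproj_mul e f x : uproj e -> uproj f -> N (e * x * f) <= N x.
Proof.
move=> /uproj_norm e1 /uproj_norm f1.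
have := unormM (e * x) f; have := unormM e x.
have := unorm_ge0 x; have := unorm_ge0 (e * x); have := unorm_ge0 e.
by have := unorm_ge0 f; nra.
Qed.

(* The hypothesis says that [y * y <= m] in the corner of s. *)
Lemma unorm_square_le s y (L m : R) : uproj s -> adj y = y -> y * s = y -> s * y = y ->
  0 <= L -> 0 < m -> N (L *: s + y * y) < L + m -> N (y * y) <= m.
Proof.
move=> [ssa ss] ysa ys sy L0 m0 H; have Lm : 0 < L + m by lra.
have Lmn0 : L + m != 0 by rewrite gt_eqF.
pose t := (L + m)^-1 *: (L *: s + y * y).
have [|x [xx _ xsa xc]] := @sqrt_one_sub t.
  by rewrite unormZ ger0_norm ?invr_ge0 ?(ltW Lm) // [ltLHS]mulrC ltr_pdivrMr // mul1r.
have tsa : adj t = t by rewrite uadjZ uadjD uadjM uadjZ ssa ysa.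
have st : s * t = t * s.
  by rewrite /t -scalerAl -scalerAr mulrDl mulrDr -scalerAl -scalerAr ss mulrA sy -mulrA ys.
have yt : y * t = t * y.
  by rewrite /t -scalerAl -scalerAr mulrDl mulrDr -scalerAl -scalerAr ys sy mulrA.
have sx := xc s st; have yx := xc y yt; have {}xsa := xsa tsa.
pose S := Num.sqrt (L + m).
have SS : S * S = L + m by rewrite -expr2 sqr_sqrtr // ltW.
(* A square root of [m *: s - y * y]. Hence [v * v + y * y = m *: s] has norm at most [m], and
   commuting squares bound [y]. *)
pose v := S *: ((1 - x) * s).
have vsa : adj v = v.
  by rewrite /v uadjZ uadjM uadjB uadj1 xsa ssa mulrBr mulrBl sx mulr1 mul1r.
have vy : v * y = y * v.
  rewrite /v -scalerAl -scalerAr -mulrA sy mulrA mulrBl mulrBr mulr1 mul1r yx.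
  by rewrite mulrBl -mulrA ys.
have vv : v * v = m *: s - y * y.
  rewrite /v -scalerAl -scalerAr scalerA SS.
  rewrite (_ : (1 - x) * s * ((1 - x) * s) = (1 - x) * (1 - x) * s); last first.
    rewrite -!mulrA; congr (_ * _); rewrite !mulrA mulrBr mulr1 sx.
    by rewrite !mulrBl ss -mulrA ss !mul1r.
  rewrite xx /t mulrBl mul1r -scalerAl mulrDl -scalerAl ss -mulrA ys.
  by nc_field R B.
have [||||_ yN] := @unorm_commuting_squares v y m => //.
  rewrite vv subrK unormZ gtr0_norm // ler_piMr ?(ltW m0) //.
  by apply: uproj_norm.
apply: le_trans (unormM _ _) _.
have -> : m = Num.sqrt m * Num.sqrt m by rewrite -expr2 sqr_sqrtr // ltW.
by apply: ler_pM => //; exact: unorm_ge0.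
Qed.

(* Compressing to the corner of r: p and w are the square roots of the inverse
   of [r * h * r] and of [r * h * r] in that corner. *)
Lemma corner_sqrt k r h : uproj r -> 0 < k -> upos k h -> adj h = h ->
  exists p w, [/\ adj p = p, r * p = p, p * r = p, p * w = r & w * p = r] /\
    [/\ w * w = r * h * r, r * w = w, N (p * p) <= k^-1 & upos 0 w].
Proof.
move=> rproj k0 [C HC] hsa; have [rsa rr] := rproj.
(* Filling the complement of [r] with the constant [C] that witnesses [upos k h] gives
   [C - g = r (C - h) r], so [g >= k] in the whole algebra. *)
pose g := r * h * r + C *: (1 - r).
have gpos : upos k g.
  exists C; apply: le_trans HC.
  have -> : C%:A - g = r * (C%:A - h) * r.
    by rewrite /g mulrBr mulrBl -scalerAr mulr1 -scalerAl rr; nc_ring R B.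
  exact: unorm_uproj_mul.
have gsa : adj g = g.
  by rewrite uadjD uadjZ uadjB uadj1 !uadjM rsa hsa !mulrA.
have rg : r * g = g * r.
  rewrite /g mulrDr mulrDl -scalerAl -scalerAr mulrBr mulrBl mulr1 mul1r rr !mulrA rr.
  by rewrite -!mulrA rr.
have [w [wsa ww [l l0 lw] wc]] := upos_sqrt k0 gpos gsa.
have [w' [ww' w'w _]] := upos_inv l0 lw.
have [z [zsa zz _ zc]] := upos_sqrt l0 lw wsa.
have rw := wc r rg; have rw' := unit_comm ww' w'w rw; have rz := zc r rw.
have w'sa := unit_adj wsa ww' w'w.
have [g' [gg' g'g g'N]] := upos_inv k0 gpos.
have g'E : g' = w' * w'.
  rewrite -[LHS]mulr1 (_ : 1 = w * w * (w' * w')); last first.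
    by rewrite -mulrA (mulrA w w') ww' mul1r ww'.
  by rewrite ww mulrA g'g mul1r.
exists (r * w'), (r * w); split; split.
- by rewrite uadjM w'sa rsa rw'.
- by rewrite mulrA rr.
- by rewrite rw' -mulrA rr.
- by rewrite rw' -mulrA (mulrA r) rr rw mulrA w'w mul1r.
- by rewrite rw -mulrA (mulrA r) rr rw' mulrA ww' mul1r.
- rewrite {2}rw -mulrA (mulrA w) ww mulrA rg -mulrA rr /g mulrDl -scalerAl mulrBl.
  by rewrite mul1r rr subrr scaler0 addr0 -mulrA rr.
- by rewrite mulrA rr.
- rewrite {2}rw' -mulrA (mulrA w') -g'E.
  by apply: le_trans g'N; rewrite mulrA; exact: unorm_uproj_mul.
rewrite (_ : r * w = r * z * (r * z)); last first.
  by rewrite {2}rz -mulrA (mulrA z) zz -rw mulrA rr.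
by apply: square_upos; rewrite uadjM zsa rsa rz.
Qed.

End FunctionalCalculus.

(** * Approximate spectral projections *)

Section Spectral.
Variables (R : realType) (A : cstarAlgType R).
Local Notation B := (unitiz A).
Implicit Types (b c d e f h m r s x y : B) (k eps : R).
Local Notation N := (@unorm R A).
Local Notation adj := (@uadj R A).

Definition sa_units_dense := forall x eps, adj x = x -> 0 < eps ->
  exists b b', [/\ adj b = b, b * b' = 1, b' * b = 1 & N (x - b) < eps].

Lemma uproj_compl e : uproj e -> uproj (1 - e).
Proof.
move=> [esa ee]; split; first by rewrite uadjB uadj1 esa.
by rewrite mulrBr mulr1 mulrBl mul1r ee subrr subr0.
Qed.

Lemma uproj_mul e f : uproj e -> uproj f -> e * f = f * e -> uproj (e * f).
Proof.
move=> [esa ee] [fsa ff] ef; split; first by rewrite uadjM esa fsa ef.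
by rewrite {2}ef -mulrA (mulrA f) ff -ef mulrA ee.
Qed.

Hypothesis dense : sa_units_dense.

(* A unit close to [a + (1 - e)] is cut down to the corner of e by a Schur
   complement. *)
Lemma corner_sa_units_dense e a eps : uproj e -> adj a = a -> e * a = a -> a * e = a ->
  0 < eps -> exists b b', [/\ adj b = b, b * b' = 1, b' * b = 1, e * b = b * e &
    N (a - e * b) <= eps].
Proof.
move=> eproj asa ea ae eps0; have [esa ee] := eproj.
have [f f_def] : {f | f = 1 - e} by exists (1 - e).
have fproj : uproj f by rewrite f_def; exact: uproj_compl.
have [fsa ff] := fproj.
have ef : e * f = 0 by rewrite f_def mulrBr mulr1 ee subrr.
have fe : f * e = 0 by rewrite f_def mulrBl mul1r ee subrr.
have eDf : e + f = 1 by rewrite f_def addrC subrK.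
have af : a * f = 0 by rewrite -ae -mulrA ef mulr0.
have fa : f * a = 0 by rewrite -ea mulrA fe mul0r.
(* [eta <= 1/2] bounds the inverse [y] by 2. The error is then at most [eta] from the corner of [e]
   plus [2 * eta^2 <= eta] from the Schur correction. *)
pose eta := Num.min (2^-1) (eps / 2).
have eta0 : 0 < eta by rewrite lt_min; apply/andP; split; lra.
have eta1 : eta <= 2^-1 by rewrite ge_min lexx.
have eta2 : eta <= eps / 2 by rewrite ge_min lexx orbT.
have [|g [g' [gsa gg' g'g gN]]] := @dense (a + f) eta _ eta0.
  by rewrite uadjD asa fsa.
have g'sa := unit_adj gsa gg' g'g.
have [t t_def] : {t | t = f - f * g * f} by exists (f - f * g * f).
have tE : t = f * (a + f - g) * f.
  by rewrite t_def mulrBr mulrBl mulrDr mulrDl fa mul0r add0r ff ff.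
have tN : N t < eta by rewrite tE; apply: le_lt_trans gN; exact: unorm_uproj_mul.
have [|y [ty yt yN]] := @neumann _ _ t; first by lra.
have ft : f * t = t by rewrite tE !mulrA ff.
have tf : t * f = t by rewrite tE -!mulrA ff.
have yf : f * y = y * f.
  by apply: unit_comm ty yt _; rewrite mulrBr mulrBl mulr1 mul1r ft tf.
have f1t : f * (1 - t) = f * g * f.
  by rewrite mulrBr mulr1 ft t_def opprB addrC subrK.
have ysa : adj y = y.
  apply: unit_adj ty yt; rewrite uadjB uadj1 t_def uadjB !uadjM fsa gsa.
  by rewrite !mulrA.
have yN2 : N y <= 2.
  apply: le_trans yN _; rewrite -[leRHS]invrK lef_pV2 ?posrE //; lra.
(* [c] inverts [f * g * f] in the corner of [f]. The Schur complement [S] is inverted in the corner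
   of [e] by the compression [e * g' * e]. *)
have [c c_def] : {c | c = f * y} by exists (f * y).
have cc : c * (f * g * f) = f by rewrite -f1t c_def mulrA -(mulrA f) -yf mulrA ff -mulrA yt mulr1.
have cf : c * f = c by rewrite c_def -mulrA -yf mulrA ff.
have fc : f * c = c by rewrite c_def mulrA ff.
have csa : adj c = c by rewrite c_def uadjM ysa fsa yf.
have [S S_def] : {S | S = e * g * e - e * g * c * g * e} by eexists.
have Ssa : adj S = S by rewrite S_def uadjB !uadjM esa gsa csa !mulrA.
have eS : e * S = S by rewrite S_def mulrBr !mulrA ee.
have Se : S * e = S by rewrite S_def mulrBl -!mulrA ee.
have Sf : S * f = 0 by rewrite -Se -mulrA ef mulr0.
have fS : f * S = 0 by rewrite -eS mulrA fe mul0r.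
have SN : N (a - S) <= eps.
  have egf : e * (a + f - g) * f = - (e * g * f).
    by rewrite mulrBr mulrBl mulrDr mulrDl ea af ef mul0r add0r sub0r.
  have fge : f * (a + f - g) * e = - (f * g * e).
    by rewrite mulrBr mulrBl mulrDr mulrDl fa mul0r add0r ff fe sub0r.
  have -> : a - S = e * (a + f - g) * e + (e * (a + f - g) * f) * y * (f * (a + f - g) * e).
    rewrite egf fge mulNr mulrNN mulrBr mulrBl mulrDr mulrDl ea ae ef mul0r addr0.
    rewrite S_def opprB addrA [RHS]addrAC; congr (_ + _ - _).
    by rewrite c_def !mulrA -(mulrA _ y f) -yf !mulrA -(mulrA _ f f) ff.
  have n1 : N (e * (a + f - g) * e) <= N (a + f - g) by exact: unorm_uproj_mul.
  have n2 : N (e * (a + f - g) * f) <= N (a + f - g) by exact: unorm_uproj_mul.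
  have n3 : N (f * (a + f - g) * e) <= N (a + f - g) by exact: unorm_uproj_mul.
  move: n1 n2 n3 gN.
  move: (e * _ * e) (e * _ * f) (f * _ * e) (N (a + f - g)) => u v w n n1 n2 n3 n4.
  apply: le_trans (unormD _ _) _.
  have := unormM (v * y) w; have := unormM v y.
  have := unorm_ge0 u; have := unorm_ge0 v; have := unorm_ge0 w.
  have := unorm_ge0 y; have := unorm_ge0 (v * y) => p1 p2 p3 p4 p5 q1 q2.
  have q3 : N (v * y) <= eta * 2 by apply: le_trans q1 _; apply: ler_pM => //; lra.
  have q4 : N (v * y * w) <= (eta * 2) * 2^-1.
    by apply: le_trans q2 _; apply: ler_pM => //; lra.
  lra.
have key : S * (e * g' * e) = e.
  have E1 : e * g * e * g' * e + e * g * f * g' * e = e.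
    by rewrite -!mulrDl -mulrDr eDf mulr1 -(mulrA e) gg' mulr1 ee.
  have E2 : f * g * e * g' * e + f * g * f * g' * e = 0.
    by rewrite -!mulrDl -mulrDr eDf mulr1 -(mulrA f) gg' mulr1 fe.
  (* The off-diagonal block equation [E2] of [g * g' = 1], solved with [c]. *)
  have E3 : f * g' * e = - (c * g * e * g' * e).
    have : c * (f * g * e * g' * e + f * g * f * g' * e) = 0 by rewrite E2 mulr0.
    rewrite mulrDr !mulrA cf => /eqP; rewrite addr_eq0 => /eqP ->.
    by rewrite opprK -{1}cc !mulrA cf.
  rewrite !mulrA Se S_def !mulrBl -[RHS]E1; congr (_ + _).
  by rewrite -!mulrA (mulrA f) E3 !mulrN !mulrA.
exists (S + f), (e * g' * e + f); split.
- by rewrite uadjD Ssa fsa.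
- by rewrite mulrDl !mulrDr key Sf ff !mulrA fe !mul0r add0r addr0 eDf.
- have key' : e * g' * e * S = e.
    by have := congr1 adj key; rewrite uadjM Ssa !uadjM esa g'sa mulrA.
  by rewrite mulrDl !mulrDr key' fS ff -!mulrA ef !mulr0 add0r addr0 eDf.
- by rewrite mulrDr mulrDl eS Se ef fe.
by rewrite mulrDr eS ef addr0.
Qed.

Definition orth_split e r s := [/\ uproj r, uproj s, r * s = 0, s * r = 0 & r + s = e].

Lemma orth_splitP e r s : orth_split e r s ->
  [/\ e * r = r, r * e = r, e * s = s & s * e = s].
Proof.
move=> [[_ rr] [_ ss] rs sr <-].
by rewrite !mulrDl !mulrDr rr rs sr ss !addr0 !add0r.
Qed.

(** Polar decomposition of an invertible self-adjoint [b] near [a] commuting with [e]: [m] is the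
    modulus of [b], its sign [q] is a self-adjoint unitary and so gives two complementary
    projections, and [d] is the error of the approximation. *)
Lemma spectral_split e a eps : uproj e -> adj a = a -> e * a = a -> a * e = a -> 0 < eps ->
  exists r s m d, [/\ orth_split e r s, adj m = m, exists2 k, 0 < k & upos k m,
    r * m = m * r /\ s * m = m * s &
    [/\ a = (r - s) * m + d, N d <= eps, adj d = d, e * d = d & d * e = d]].
Proof.
move=> eproj asa ea ae eps0; have [esa ee] := eproj.
have [b [b' [bsa bb' b'b eb ab]]] := corner_sa_units_dense eproj asa ea ae eps0.
have b'sa := unit_adj bsa bb' b'b; have eb' := unit_comm bb' b'b eb.
have [k k0 kb] := unit_square_upos bsa bb' b'b.
have [|m [msa mm mpos mc]] := upos_sqrt k0 kb; first by rewrite uadjM bsa.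
have bm : b * m = m * b by rewrite mc // mulrA.
have em : e * m = m * e by rewrite mc // mulrA eb -mulrA eb mulrA.
have b'm : b' * m = m * b' by rewrite -(unit_comm bb' b'b (esym bm)).
have [q q_def] : {q | q = b' * m} by eexists.
have qsa : adj q = q by rewrite q_def uadjM msa b'sa b'm.
have qq : q * q = 1.
  by rewrite q_def {2}b'm -mulrA (mulrA m) mm -!mulrA bb' mulr1 b'b.
have eq : e * q = q * e by rewrite q_def mulrA eb' -!mulrA em.
have qm : q * m = m * q by rewrite q_def -mulrA {1}b'm mulrA -b'm !mulrA b'm.
have qmE : q * m = b by rewrite q_def -mulrA mm mulrA b'b mul1r.
have [h [hproj eh hm hE]] : exists h,
    [/\ uproj h, e * h = h * e, h * m = m * h & h - (1 - h) = q].
  exists (2^-1 *: (1 + q)); split; last by nc_field R B.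
  - split; first by rewrite uadjZ uadjD uadj1 qsa.
    rewrite (_ : _ * _ = 4^-1 *: (1 + 2 *: q + q * q)); last by nc_field R B.
    by rewrite qq; nc_field R B.
  - by rewrite -scalerAl -scalerAr mulrDr mulrDl mulr1 mul1r eq.
  by rewrite -scalerAl -scalerAr mulrDr mulrDl mulr1 mul1r qm.
have gproj := uproj_compl hproj; have [_ hh] := hproj.
have eg : e * (1 - h) = (1 - h) * e by rewrite mulrBr mulrBl mulr1 mul1r eh.
have gm : (1 - h) * m = m * (1 - h) by rewrite mulrBr mulrBl mulr1 mul1r hm.
have hg : h * (1 - h) = 0 by rewrite mulrBr mulr1 hh subrr.
have gh : (1 - h) * h = 0 by rewrite mulrBl mul1r hh subrr.
exists (e * h), (e * (1 - h)), m, (a - e * b); split=> //.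
- split; [exact: uproj_mul|exact: uproj_mul| | |].
  + by rewrite eg -mulrA (mulrA h) hg mul0r mulr0.
  + by rewrite {1}eg -mulrA (mulrA e) ee eh mulrA gh mul0r.
  by rewrite -mulrDr addrC subrK mulr1.
- by rewrite -!mulrA hm gm !mulrA em.
split=> //; last 3 first.
- by rewrite uadjB uadjM asa bsa esa eb.
- by rewrite mulrBr ea mulrA ee.
- by rewrite mulrBl ae {1}eb -mulrA ee -eb.
rewrite -mulrBr hE.
by rewrite -mulrA qmE addrC subrK.
Qed.

(* The scalars of the exchange argument: r and s split e almost spectrally with
   respect to a, and [e + c] is the sum of the two square roots, up to a small
   error, plus e. *)
Lemma exchange_scalars e a : uproj e -> adj a = a -> e * a = a -> a * e = a ->
  exists (r s p k M : B), [/\ orth_split e r s,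
    [/\ adj p = p, r * p = p, p * r = p & p * a * p = r],
    [/\ adj k = k, s * k = k, k * s = k & k * (e - a) * k = s] &
    [/\ e * M = M, M * e = M, M * (e + (a * p + (e - a) * k)) = e &
        (e + (a * p + (e - a) * k)) * M = e]].
Proof.
move=> eproj asa ea ae; have [esa ee] := eproj.
(* The shift by 1/2 makes both [r a r] and [s (e - a) s] at least [1/2 - 1/16 = 7/16] in their
   corners. *)
have [||||r [s [m [d [rs msa [l l0 lm] [rm sm] [aE dN dsa ed de]]]]]] :=
  @spectral_split e (a - 2^-1 *: e) 16^-1 eproj => //.
- by rewrite uadjB uadjZ asa esa.
- by rewrite mulrBr ea -scalerAr ee.
- by rewrite mulrBl ae -scalerAl ee.
have [er re es se] := orth_splitP rs.
have [rproj sproj r_s s_r rDs] := rs; have [[rsa rr] [ssa ss]] := (rproj, sproj).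
have [q [aE' rq sq]] : exists q, [/\ a = 2^-1 *: e + q * m + d, r * q = r & s * q = - s].
  exists (r - s); split; first by rewrite -addrA -aE addrC subrK.
    by rewrite mulrBr rr r_s subr0.
  by rewrite mulrBr ss s_r sub0r.
have m0 : upos 0 m.
  by case: lm => C HC; exists C; apply: le_trans HC _; lra.
have hpos (x : B) : N x <= 16^-1 -> upos (7 / 16) ((2^-1)%:A + m + x).
  move=> xN; rewrite (_ : 7 / 16 = 2^-1 + 0 - 16^-1); last by field.
  by apply: upos_perturb => //; apply: uposD => //; exact: upos_const.
have c0 : (0 : R) < 7 / 16 by lra.
have [|p [w [[psa rp pr pw wp] [ww rw pN w0]]]] :=
  corner_sqrt rproj c0 (hpos d dN); first by rewrite !uadjD uadjZ uadj1 msa dsa.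
have [||k [v [[ksa sk ks kv vk] [vv sv kN v0]]]] :=
  @corner_sqrt _ _ _ s ((2^-1)%:A + m - d) sproj c0.
- by apply: hpos; rewrite unormN.
- by rewrite uadjB uadjD uadjZ uadj1 msa dsa.
have aexp x y : x * e = x -> x * a * y = 2^-1 *: (x * y) + x * q * (m * y) + x * d * y.
  move=> xe; rewrite aE' !mulrDr !mulrDl -scalerAr -scalerAl xe.
  by rewrite !mulrA.
have rar : r * a * r = w * w.
  by rewrite ww (aexp _ _ re) rq !mulrDr !mulrDl -scalerAr -scalerAl mulr1 !mulrA.
have sas : s * (e - a) * s = v * v.
  rewrite vv mulrBr mulrBl se ss (aexp _ _ se) sq !mulrDr !mulrDl -scalerAr -scalerAl.
  by rewrite mulr1 ss mulrN !mulNr !mulrA; nc_field R B.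
have sar : s * a * r = s * d * r.
  rewrite (aexp _ _ se) sq s_r scaler0 add0r mulNr mulrA sm -(mulrA m) s_r mulr0 oppr0.
  by rewrite add0r.
have ras : r * (e - a) * s = - (r * d * s).
  rewrite mulrBr mulrBl re r_s (aexp _ _ re) rq r_s scaler0 add0r mulrA rm.
  by rewrite -(mulrA m) r_s mulr0 !add0r.
have apE : a * p = w + s * d * p.
  have -> : a * p = r * a * r * p + s * a * r * p.
    by rewrite -!mulrDl rDs ea -mulrA rp.
  by rewrite rar sar -!mulrA wp rp -pw mulrA wp rw.
have akE : (e - a) * k = v - r * d * k.
  have -> : (e - a) * k = s * (e - a) * s * k + r * (e - a) * s * k.
    by rewrite -!mulrDl (addrC s) rDs mulrBr ee ea -mulrA sk.
  by rewrite sas ras mulNr -!mulrA vk sk -kv mulrA vk sv.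
have pN2 : N p <= 2.
  have := unorm_cstar_le p; rewrite psa => H; have := unorm_ge0 p.
  have := le_trans H pN; have -> : (7 / 16 : R)^-1 = 16 / 7 by field.
  nra.
have kN2 : N k <= 2.
  have := unorm_cstar_le k; rewrite ksa => H; have := unorm_ge0 k.
  have := le_trans H kN; have -> : (7 / 16 : R)^-1 = 16 / 7 by field.
  nra.
have small x y z : uproj x -> N y <= 16^-1 -> N z <= 2 -> N (x * y * z) <= 8^-1.
  move=> /uproj_norm x1 y1 z1; have := unormM (x * y) z; have := unormM x y.
  have := unorm_ge0 x; have := unorm_ge0 y; have := unorm_ge0 z; have := unorm_ge0 (x * y).
  nra.
(* The bound 16/7 on [p * p] and [k * k] gives norms at most 2, so each off-diagonal error is at
   most 2/16, and together they cost at most 1/4. *)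
have Gpos : upos (3 / 4) (1 + w + v + (s * d * p - r * d * k)).
  rewrite (_ : 3 / 4 = 1 + 0 + 0 - 4^-1); last by field.
  apply: upos_perturb.
    apply: uposD => //; apply: uposD => //.
    by rewrite -(scale1r (1 : B)); exact: upos_const.
  apply: le_trans (unormB _ _) _.
  by have := small s d p sproj dN pN2; have := small r d k rproj dN kN2; lra.
have [|G' [GG' G'G _]] := upos_inv _ Gpos; first lra.
have ew : e * w = w by rewrite -rw mulrA er.
have wr : w * r = w by rewrite -pw mulrA wp rw.
have we : w * e = w by rewrite -wr -mulrA re.
have ev : e * v = v by rewrite -sv mulrA es.
have vs : v * s = v by rewrite -kv mulrA vk sv.
have ve : v * e = v by rewrite -vs -mulrA se.
have pe : p * e = p by rewrite -pr -mulrA re.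
have ke : k * e = k by rewrite -ks -mulrA se.
have [G G_def] : {G | G = 1 + w + v + (s * d * p - r * d * k)} by eexists.
rewrite -G_def in Gpos GG' G'G.
have eG : e * G = e + (a * p + (e - a) * k).
  rewrite apE akE G_def !mulrDr mulrN mulr1 ew ev !mulrA es er.
  by nc_ring R B.
have Ge : G * e = e * G.
  rewrite eG apE akE G_def !mulrDl mulNr mul1r we ve -!mulrA pe ke.
  by nc_ring R B.
have eG' := unit_comm GG' G'G (esym Ge).
exists r, s, p, k, (e * G'); rewrite -eG; split=> //; split=> //.
- rewrite (_ : p * a * p = p * (r * a * r) * p); last first.
    by rewrite !mulrA pr -(mulrA _ r p) rp.
  by rewrite rar mulrA pw -mulrA wp rr.
- rewrite (_ : k * (e - a) * k = k * (s * (e - a) * s) * k); last first.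
    by rewrite !mulrA ks -(mulrA _ s k) sk.
  by rewrite sas mulrA kv -mulrA vk ss.
- by rewrite mulrA ee.
- by rewrite {1}eG' -mulrA ee eG'.
- by rewrite {1}eG' mulrA -(mulrA G') ee -eG' -mulrA G'G mulr1.
- by rewrite -Ge mulrA -(mulrA G) ee Ge -mulrA GG' mulr1.
Qed.



End Spectral.

(** * Real rank zero of the unitization *)

Section RealRankZeroUnitization.
Variables (R : realType) (A : cstarAlgType R).
Local Notation B := (unitiz A).
Local Notation N := (@unorm R A).
Local Notation adj := (@uadj R A).

Lemma ballC_rnorm (V : normedModType R[i]) (x y : V) (eps : R) :
  ball x eps%:C y -> rnorm (x - y) < eps.
Proof. by rewrite -ball_normE /= -rnorm_lt. Qed.

Lemma nonunital_sa_units_dense :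
  invertible_sa_dense (@unitization_mul R A) (@unitization_adj R A) (0, 1) ->
  sa_units_dense A.
Proof.
move=> H x eps xsa eps0.
have e2 : 0 < (eps / 2)%:C :> R[i] by rewrite ltcR; lra.
have [b [[bsa [b' [bb' b'b]]] xb]] :=
  H (x : A * R[i]^o) xsa _ (nbhsx_ballx (x : A * R[i]^o) _ e2).
exists b, b'; split=> //; apply: le_lt_trans (unorm_le_sum _) _.
case: xb => /ballC_rnorm xb1 /ballC_rnorm xb2.
by have := ltrD xb1 xb2; rewrite -splitr.
Qed.

(** With a unit [e] in [A], the unitization is the direct sum of [A] and the scalar multiples of
    [1 - e]. The component [a + k e] is approximated in [A], and the scalar [k], real by
    self-adjointness, by a nonzero real. *)
Lemma unital_sa_units_dense (e : A) : is_unit e ->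
  invertible_sa_dense (@cmul R A) (@cadj R A) e -> sa_units_dense A.
Proof.
move=> eU H x eps xsa eps0; case: x xsa => a k xsa.
have ak : cadj a = a /\ k^* = k by case: xsa.
have kR : k = (complex.Re k)%:C.
  case: k ak {xsa} => k1 k2 [_ [/eqP]]; rewrite eq_sym -addr_eq0 -mulr2n mulrn_eq0 /=.
  by move=> /eqP ->.
set kap := complex.Re k in kR.
have esa : cadj e = e.
  have ee := proj1 (eU (cadj e)).
  by have := congr1 (@cadj R A) ee; rewrite cadjM cadjK ee.
have asa : cadj (a + kap%:C *: e) = a + kap%:C *: e.
  by rewrite cadjD cadj_conjc conjc_real esa ak.1.
have e2 : 0 < (eps / 2)%:C :> R[i] by rewrite ltcR; lra.
have [b [[bsa [y [by_ yb]]] /ballC_rnorm xb]] := H _ asa _ (nbhsx_ballx _ _ e2).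
have [l [l0 kl]] : exists l, l != 0 /\ `|kap - l| <= eps / 4.
  have [->|] := eqVneq kap 0; last by exists kap; rewrite subrr normr0; split=> //; lra.
  exists (eps / 4); rewrite sub0r normrN ger0_norm; last by lra.
  by split=> //; rewrite gt_eqF //; lra.
pose E : B := inA e; pose bB : B := inA b; pose yB : B := inA y.
have EE : E * E = E by rewrite -inA_M (proj1 (eU e)).
have Eb : E * bB = bB by rewrite -inA_M (proj1 (eU b)).
have bE : bB * E = bB by rewrite -inA_M (proj2 (eU b)).
have Ey : E * yB = yB by rewrite -inA_M (proj1 (eU y)).
have yE : yB * E = yB by rewrite -inA_M (proj2 (eU y)).
have byE : bB * yB = E by rewrite -inA_M by_.
have ybE : yB * bB = E by rewrite -inA_M yb.
have Esa : adj E = E by rewrite -inA_adj esa.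
have Eproj : uproj E by [].
exists (bB + l *: (1 - E)), (yB + l^-1 *: (1 - E)); split.
- by rewrite uadjD uadjZ uadjB uadj1 Esa -inA_adj bsa.
- rewrite (_ : _ * _ = bB * yB + l^-1 *: (bB - bB * E) + l *: (yB - E * yB) +
    (1 - E - E + E * E)); last by nc_field R B.
  by rewrite byE bE Ey EE !subrr !scaler0 !addr0 subrK addrC subrK.
- rewrite (_ : _ * _ = yB * bB + l *: (yB - yB * E) + l^-1 *: (bB - E * bB) +
    (1 - E - E + E * E)); last by nc_field R B.
  by rewrite ybE Eb yE EE !subrr !scaler0 !addr0 subrK addrC subrK.
have -> : (a, k) - (bB + l *: (1 - E)) = inA (a + kap%:C *: e - b) + (kap - l) *: (1 - E) :> B.
  apply: unitiz_eq.
    rewrite /= !sub0r !scalerN rmorphB /= scalerBl opprB opprD opprK.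
    by rewrite [RHS](AC (3*2) (1*(5*3)*(2*4)))%AC /= subrr addr0.
  by rewrite /= !subr0 !mulr1 add0r {1}kR add0r rmorphB.
apply: le_lt_trans (unormD _ _) _; rewrite unormZ.
have := unorm_inA (a + kap%:C *: e - b); have := uproj_norm (uproj_compl Eproj).
have := unorm_ge0 (1 - E); have := normr_ge0 (kap - l).
nra.
Qed.

Lemma real_rank_zero_dense : real_rank_zero A -> sa_units_dense A.
Proof.
move=> [unit_case nonunit_case].
have [[e eU]|nU] := pselect (unital A).
  exact: unital_sa_units_dense eU (unit_case e eU).
exact: nonunital_sa_units_dense (nonunit_case nU).
Qed.

End RealRankZeroUnitization.

(** * Exchange for matrices over the unitization *)

Section MatrixExchange.
Variables (R : realType) (A : cstarAlgType R).
Local Notation B := (unitiz A).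
Local Notation adj := (@uadj R A).

Definition madj m n (X : 'M[B]_(m, n)) : 'M[B]_(n, m) := \matrix_(i, j) adj (X j i).

Lemma uadj_sum I (s : seq I) (F : I -> B) : adj (\sum_(i <- s) F i) = \sum_(i <- s) adj (F i).
Proof. by apply: (big_morph adj) => [x y|]; rewrite ?uadjD ?uadj0. Qed.

Lemma madjM m n p (X : 'M[B]_(m, n)) (Y : 'M[B]_(n, p)) :
  madj (X *m Y) = madj Y *m madj X.
Proof.
apply/matrixP => i j; rewrite !mxE uadj_sum.
by apply: eq_bigr => l _; rewrite !mxE uadjM.
Qed.

Lemma madjD m n (X Y : 'M[B]_(m, n)) : madj (X + Y) = madj X + madj Y.
Proof. by apply/matrixP => i j; rewrite !mxE uadjD. Qed.

Lemma madjN m n (X : 'M[B]_(m, n)) : madj (- X) = - madj X.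
Proof. by apply/matrixP => i j; rewrite !mxE uadjN. Qed.

Lemma madjK m n (X : 'M[B]_(m, n)) : madj (madj X) = X.
Proof. by apply/matrixP => i j; rewrite !mxE uadjK. Qed.

Lemma madj0 m n : madj 0 = 0 :> 'M[B]_(n, m).
Proof. by apply/matrixP => i j; rewrite !mxE uadj0. Qed.

Lemma madj_scalar n (x : B) : madj x%:M = (adj x)%:M :> 'M[B]_n.
Proof.
by apply/matrixP => i j; rewrite !mxE eq_sym; case: (i == j); rewrite ?mulr1n ?mulr0n ?uadj0.
Qed.

Lemma madj1 n : madj 1%:M = 1%:M :> 'M[B]_n.
Proof. by rewrite madj_scalar uadj1. Qed.

Definition mproj n (P : 'M[B]_n) := madj P = P /\ P *m P = P.

Lemma scalar_mx1_inj : injective (fun x : B => x%:M : 'M[B]_1).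
Proof. by move=> x y /matrixP/(_ ord0 ord0); rewrite !mxE eqxx !mulr1n. Qed.

Lemma scalar_mx_sub n (x y : B) : (x - y)%:M = x%:M - y%:M :> 'M[B]_n.
Proof. by rewrite raddfB. Qed.

Lemma scalar_mx_add n (x y : B) : (x + y)%:M = x%:M + y%:M :> 'M[B]_n.
Proof. by rewrite raddfD. Qed.

(* A generalized Householder reflection carrying rho to - X. *)
Lemma reflection_exists n (e M : B) (rho X : 'M[B]_(1, n)) (c : B) :
  uproj e -> e * M = M -> M * e = M -> M * (e + c) = e -> (e + c) * M = e ->
  e%:M *m rho = rho -> e%:M *m X = X ->
  rho *m madj rho = e%:M -> X *m madj X = e%:M -> rho *m madj X = c%:M ->
  exists S : 'M[B]_n, [/\ S *m madj S = 1%:M, madj S *m S = 1%:M, rho *m S = - X &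
    forall U, madj U = U -> rho *m U = rho -> X *m U = X -> S *m U = U *m S].
Proof.
move=> [esa ee] eM Me MD DM erho eX rr XX rX.
have Xr : X *m madj rho = (adj c)%:M by rewrite -madj_scalar -rX madjM madjK.
(* Since [rho Y^* = D] and [D M = e], the matrix [S = 1 - Y^* M Y] sends [rho] to
   [rho - Y = - X]. *)
have [Y Y_def] : {Y | Y = rho + X} by eexists.
have [D D_def] : {D | D = e + c} by eexists.
rewrite -D_def in MD DM.
have YY : Y *m madj Y = (D + adj D)%:M.
  rewrite Y_def madjD mulmxDl !mulmxDr rr XX rX Xr -!scalar_mx_add D_def uadjD esa.
  by congr (_%:M); rewrite [adj c + e]addrC.
have eY : e%:M *m Y = Y by rewrite Y_def mulmxDr erho eX.
have rY : rho *m madj Y = D%:M by rewrite Y_def madjD mulmxDr rr rX -scalar_mx_add D_def.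
have eMa : e * adj M = adj M by rewrite -{1}esa -uadjM Me.
have Mae : adj M * e = adj M by rewrite -{1}esa -uadjM eM.
have DaMa : adj D * adj M = e by rewrite -uadjM MD esa.
have MaDa : adj M * adj D = e by rewrite -uadjM DM esa.
have [S S_def] : {S | S = 1%:M - madj Y *m (M%:M *m Y)} by eexists.
have Sa : madj S = 1%:M - madj Y *m ((adj M)%:M *m Y).
  by rewrite S_def madjD madjN madj1 !madjM madjK madj_scalar mulmxA.
(* Used with [M] and [adj M] in both orders; the premise then reduces to [M] and [D] being inverse
   to each other in the corner. *)
have prod (x y : B) : x * (D + adj D) * y = x + y ->
    (1%:M - madj Y *m (x%:M *m Y)) *m (1%:M - madj Y *m (y%:M *m Y)) = 1%:M.
  move=> xy; rewrite mulmxBr mulmx1 mulmxBl mul1mx.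
  have -> : madj Y *m (x%:M *m Y) *m (madj Y *m (y%:M *m Y)) =
      madj Y *m (x%:M *m Y) + madj Y *m (y%:M *m Y).
    rewrite -mulmxDr -mulmxDl -scalar_mx_add -xy !scalar_mxM.
    by rewrite -!mulmxA (mulmxA Y) YY.
  by rewrite opprB addrK subrK.
exists S; split.
- rewrite Sa S_def; apply: prod; rewrite mulrDr mulrDl MD eMa -mulrA DaMa Me.
  by rewrite addrC.
- rewrite Sa S_def; apply: prod; rewrite mulrDr mulrDl -mulrA DM Mae MaDa eM //.
- rewrite S_def mulmxBr mulmx1 (mulmxA rho) rY mulmxA -scalar_mxM DM eY Y_def opprD addrA subrr.
  by rewrite add0r.
move=> U Usa rU XU; have YU : Y *m U = Y by rewrite Y_def mulmxDl rU XU.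
have UY : U *m madj Y = madj Y by rewrite -{1}Usa -madjM YU.
rewrite S_def mulmxBl mulmxBr mul1mx mulmx1; congr (_ - _).
by rewrite [RHS]mulmxA UY -[LHS]mulmxA -(mulmxA _ Y) YU.
Qed.

Hypothesis dense : sa_units_dense A.

(** The rows [rho] and [kappa] together parametrize [Q1 + Q2]. A unitary [S] commuting with
    [Q1 + Q2] turns [rho] into [- (X1 + X2)], whose two pieces lie under [Q1] and [Q2] separately;
    [W = kappa S] then covers exactly what these pieces leave over. *)
Lemma exchange_mx n l (e : B) (Q1 Q2 : 'M[B]_n) (rho : 'M[B]_(1, n)) (kappa : 'M[B]_(l, n)) :
  uproj e -> mproj Q1 -> mproj Q2 -> Q1 *m Q2 = 0 ->
  e%:M *m rho = rho -> rho *m madj rho = e%:M -> rho *m madj kappa = 0 ->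
  madj rho *m rho + madj kappa *m kappa = Q1 + Q2 ->
  exists (r s : B) (X1 X2 : 'M[B]_(1, n)) (W : 'M[B]_(l, n)),
  [/\ orth_split e r s,
    [/\ X1 *m madj X1 = r%:M, r%:M *m X1 = X1 & X1 *m Q1 = X1],
    [/\ X2 *m madj X2 = s%:M, s%:M *m X2 = X2 & X2 *m Q2 = X2] &
    [/\ W *m madj W = kappa *m madj kappa,
        madj W *m W = (Q1 - madj X1 *m X1) + (Q2 - madj X2 *m X2) &
        forall P, P *m kappa = kappa -> P *m W = W]].
Proof.
move=> eproj [Q1sa Q1Q1] [Q2sa Q2Q2] Q12 erho rr rk UE; have [esa ee] := eproj.
have Q21 : Q2 *m Q1 = 0 by rewrite -Q1sa -Q2sa -madjM Q12 madj0.
have rU : rho *m (Q1 + Q2) = rho.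
  by rewrite -UE mulmxDr mulmxA rr erho mulmxA rk mul0mx addr0.
have rhoe : madj rho *m e%:M = madj rho by rewrite -[in LHS]esa -madj_scalar -madjM erho.
have [a aE] : exists a, rho *m Q1 *m madj rho = a%:M by eexists; exact: mx11_scalar.
have asa : adj a = a.
  by apply: scalar_mx1_inj; rewrite /= -madj_scalar -aE !madjM madjK Q1sa mulmxA.
have ea : e * a = a.
  by apply: scalar_mx1_inj; rewrite /= scalar_mxM -aE !mulmxA erho.
have ae : a * e = a.
  by apply: scalar_mx1_inj; rewrite /= scalar_mxM -aE -!mulmxA rhoe.
have aE2 : rho *m Q2 *m madj rho = (e - a)%:M.
  have := rr; rewrite -{1}rU mulmxDr mulmxDl aE => /(canRL (addKr _)) ->.
  by rewrite scalar_mx_sub addrC.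
have [r [s [p [k [M [rs [psa rp pr pap] [ksa sk ks kak] [eM Me MD DM]]]]]]] :=
  exchange_scalars dense eproj asa ea ae.
have [er re es se] := orth_splitP rs; have [_ _ r_s s_r rDs] := rs.
have pk0 : p * k = 0 by rewrite -pr -sk mulrA -(mulrA p) r_s mulr0 mul0r.
(* [p] and [k] are inverse square roots of the compressions [a] on [r] and [e - a] on [s], which
   makes [X1] and [X2] partial isometries. *)
have [X1 X1_def] : {X1 | X1 = p%:M *m rho *m Q1} by eexists.
have [X2 X2_def] : {X2 | X2 = k%:M *m rho *m Q2} by eexists.
have X1a : madj X1 = Q1 *m madj rho *m p%:M.
  by rewrite X1_def !madjM madj_scalar psa Q1sa mulmxA.
have X2a : madj X2 = Q2 *m madj rho *m k%:M.
  by rewrite X2_def !madjM madj_scalar ksa Q2sa mulmxA.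
have X1Q1 : X1 *m Q1 = X1 by rewrite X1_def -mulmxA Q1Q1.
have X2Q2 : X2 *m Q2 = X2 by rewrite X2_def -mulmxA Q2Q2.
have X1Q2 : X1 *m Q2 = 0 by rewrite -X1Q1 -mulmxA Q12 mulmx0.
have X2Q1 : X2 *m Q1 = 0 by rewrite -X2Q2 -mulmxA Q21 mulmx0.
have X11 : X1 *m madj X1 = r%:M.
  rewrite X1a X1_def !mulmxA -(mulmxA _ Q1 Q1) Q1Q1 -(mulmxA p%:M) -(mulmxA p%:M) aE.
  by rewrite -!scalar_mxM pap.
have X22 : X2 *m madj X2 = s%:M.
  rewrite X2a X2_def !mulmxA -(mulmxA _ Q2 Q2) Q2Q2 -(mulmxA k%:M) -(mulmxA k%:M) aE2.
  by rewrite -!scalar_mxM kak.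
have X12 : X1 *m madj X2 = 0 by rewrite X2a !mulmxA X1Q2 !mul0mx.
have X21 : X2 *m madj X1 = 0 by rewrite X1a !mulmxA X2Q1 !mul0mx.
have X1aX2 : madj X1 *m X2 = 0.
  rewrite X1a X2_def !mulmxA -(mulmxA _ p%:M) -scalar_mxM pk0.
  by rewrite raddf0 mulmx0 !mul0mx.
have X2aX1 : madj X2 *m X1 = 0 by rewrite -[X1]madjK -madjM X1aX2 madj0.
have rX1 : r%:M *m X1 = X1 by rewrite X1_def !mulmxA -scalar_mxM rp.
have sX2 : s%:M *m X2 = X2 by rewrite X2_def !mulmxA -scalar_mxM sk.
have [X X_def] : {X | X = X1 + X2} by eexists.
have eX : e%:M *m X = X.
  rewrite X_def mulmxDr -{1}rX1 -{1}sX2 !mulmxA -!scalar_mxM er es.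
  by rewrite rX1 sX2.
have XX : X *m madj X = e%:M.
  by rewrite X_def madjD mulmxDl !mulmxDr X11 X22 X12 X21 addr0 add0r -scalar_mx_add rDs.
have rX : rho *m madj X = (a * p + (e - a) * k)%:M.
  by rewrite X_def madjD mulmxDr X1a X2a !mulmxA aE aE2 -!scalar_mxM -scalar_mx_add.
have [S [SS SaS rS SU]] :=
  reflection_exists eproj eM Me MD DM erho eX rr XX rX.
have XU : X *m (Q1 + Q2) = X.
  by rewrite X_def mulmxDl !mulmxDr X1Q1 X2Q2 X1Q2 X2Q1 addr0 add0r.
have US : S *m (Q1 + Q2) = (Q1 + Q2) *m S by apply: SU; rewrite ?madjD ?Q1sa ?Q2sa.
exists r, s, X1, X2, (kappa *m S); split=> //; split.
- by rewrite madjM mulmxA -(mulmxA kappa) SS mulmx1.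
- have kk : madj kappa *m kappa = Q1 + Q2 - madj rho *m rho by rewrite -UE addrC addKr.
  rewrite madjM mulmxA -(mulmxA (madj S)) kk mulmxBr mulmxBl -(mulmxA (madj S) _ S) -US.
  rewrite !mulmxA SaS mul1mx -madjM rS -mulmxA rS madjN mulNmx mulmxN opprK.
  rewrite X_def madjD mulmxDl !mulmxDr X1aX2 X2aX1 addr0 add0r.
  by rewrite opprD addrACA.
by move=> P Pk; rewrite mulmxA Pk.
Qed.

End MatrixExchange.

(** * Classes of projections *)

Section ClassesOfProjections.
Variables (R : realType) (A : cstarAlgType R).
Local Notation B := (unitiz A).
Local Notation adj := (@uadj R A).

Definition emb m n (X : 'M[A]_(m, n)) : 'M[B]_(m, n) := map_mx (@inA R A) X.
Definition unemb m n (X : 'M[B]_(m, n)) : 'M[A]_(m, n) := map_mx (fun b : B => b.1) X.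
Definition mideal m n (X : 'M[B]_(m, n)) := forall i j, in_ideal (X i j).

Lemma inA_sum I (s : seq I) (F : I -> A) :
  inA (\sum_(i <- s) F i) = \sum_(i <- s) inA (F i).
Proof. by apply: (big_morph (@inA R A)) => [x y|]; rewrite ?inA_D. Qed.

Lemma embM m n p (X : 'M[A]_(m, n)) (Y : 'M[A]_(n, p)) : emb (mxmul X Y) = emb X *m emb Y.
Proof.
apply/matrixP => i j; rewrite !mxE inA_sum.
by apply: eq_bigr => k _; rewrite !mxE inA_M.
Qed.

Lemma emb_adj m n (X : 'M[A]_(m, n)) : emb (mxadj X) = madj (emb X).
Proof. by apply/matrixP => i j; rewrite !mxE inA_adj. Qed.

Lemma emb_inj m n : injective (@emb m n).
Proof.
move=> X Y /matrixP XY; apply/matrixP => i j.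
by have := XY i j; rewrite !mxE => /inA_inj.
Qed.

Lemma embK m n : cancel (@emb m n) (@unemb m n).
Proof. by move=> X; apply/matrixP => i j; rewrite !mxE. Qed.

Lemma unembK m n (X : 'M[B]_(m, n)) : mideal X -> emb (unemb X) = X.
Proof. by move=> XI; apply/matrixP => i j; rewrite !mxE -in_idealP. Qed.

Lemma mideal_emb m n (X : 'M[A]_(m, n)) : mideal (emb X).
Proof. by move=> i j; rewrite mxE. Qed.

Lemma in_ideal_sum I (s : seq I) (F : I -> B) :
  (forall i, in_ideal (F i)) -> in_ideal (\sum_(i <- s) F i).
Proof. by move=> FI; apply: big_ind => //; exact: in_idealD. Qed.

Lemma midealMl m n p (X : 'M[B]_(m, n)) (Y : 'M[B]_(n, p)) : mideal X -> mideal (X *m Y).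
Proof. by move=> XI i j; rewrite mxE; apply: in_ideal_sum => k; apply: (in_idealM _ _).1. Qed.

Lemma midealMr m n p (X : 'M[B]_(m, n)) (Y : 'M[B]_(n, p)) : mideal Y -> mideal (X *m Y).
Proof. by move=> YI i j; rewrite mxE; apply: in_ideal_sum => k; apply: (in_idealM _ _).2. Qed.

Lemma midealD m n (X Y : 'M[B]_(m, n)) : mideal X -> mideal Y -> mideal (X + Y).
Proof. by move=> XI YI i j; rewrite mxE; apply: in_idealD. Qed.

Lemma midealB m n (X Y : 'M[B]_(m, n)) : mideal X -> mideal Y -> mideal (X - Y).
Proof.
move=> XI YI i j; rewrite !mxE /in_ideal /=.
by have := XI i j; have := YI i j; rewrite /in_ideal => -> ->; rewrite subr0.
Qed.

Lemma mideal0 m n : mideal (0 : 'M[B]_(m, n)).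
Proof. by move=> i j; rewrite mxE. Qed.

Lemma mideal_block m1 m2 n1 n2 (X : 'M[B]_(m1, n1)) Y Z (T : 'M[B]_(m2, n2)) :
  mideal X -> mideal Y -> mideal Z -> mideal T -> mideal (block_mx X Y Z T).
Proof.
move=> XI YI ZI TI i j.
by case: (split_ordP i) => i' ->; case: (split_ordP j) => j' ->;
  rewrite ?block_mxEul ?block_mxEur ?block_mxEdl ?block_mxEdr.
Qed.

Lemma mideal_scalar (x : B) : in_ideal x <-> mideal (x%:M : 'M[B]_1).
Proof.
split=> [xI i j|/(_ ord0 ord0)]; last by rewrite mxE eqxx mulr1n.
by rewrite mxE !ord1 eqxx mulr1n.
Qed.

Lemma madj_block m1 m2 n1 n2 (X : 'M[B]_(m1, n1)) Y Z (T : 'M[B]_(m2, n2)) :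
  madj (block_mx X Y Z T) = block_mx (madj X) (madj Z) (madj Y) (madj T).
Proof.
apply/matrixP => i j.
case: (split_ordP i) => i' ->; case: (split_ordP j) => j' ->;
by rewrite mxE ?block_mxEul ?block_mxEur ?block_mxEdl ?block_mxEdr [RHS]mxE.
Qed.

Lemma madj_row m n1 n2 (X : 'M[B]_(m, n1)) (Y : 'M[B]_(m, n2)) :
  madj (row_mx X Y) = col_mx (madj X) (madj Y).
Proof.
apply/matrixP => i j; case: (split_ordP i) => i' ->;
by rewrite mxE ?row_mxEl ?row_mxEr ?col_mxEu ?col_mxEd [RHS]mxE.
Qed.

Lemma madj_col m1 m2 n (X : 'M[B]_(m1, n)) (Y : 'M[B]_(m2, n)) :
  madj (col_mx X Y) = row_mx (madj X) (madj Y).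
Proof. by rewrite -[RHS]madjK madj_row !madjK. Qed.

Definition iproj n (P : 'M[B]_n) := mproj P /\ mideal P.

Lemma iproj_emb (p : projection A) : iproj (emb (pmx p)).
Proof.
split; last exact: mideal_emb.
by split; rewrite -?emb_adj -?embM ?pmx_adj ?pmx_idem.
Qed.

Lemma unemb_adj n (P : 'M[B]_n.+1) : iproj P -> mxadj (unemb P) = unemb P.
Proof. by move=> [[Psa _] PI]; apply: emb_inj; rewrite emb_adj unembK. Qed.

Lemma unemb_idem n (P : 'M[B]_n.+1) : iproj P -> mxmul (unemb P) (unemb P) = unemb P.
Proof. by move=> [[_ PP] PI]; apply: emb_inj; rewrite embM unembK. Qed.

(* The class in V(A) of a projection over the ideal A of the unitization, and 0
   on other matrices. *)
Definition vcl n (P : 'M[B]_n.+1) : V A :=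
  match pselect (iproj P) with
  | left PP => V_class (Projection (unemb_adj PP) (unemb_idem PP))
  | right _ => 0
  end.

Lemma vcl_emb (p : projection A) : vcl (emb (pmx p)) = V_class p.
Proof.
rewrite /vcl; case: pselect => [H|/(_ (iproj_emb p))//]; congr V_class.
by apply: (@projection_eq R A (Projection _ _) p (erefl (psize p).+1)); rewrite castmx_id /= embK.
Qed.

Lemma vcl_surj (x : V A) : exists n (P : 'M[B]_n.+1), iproj P /\ x = vcl P.
Proof.
elim/V_ind: x => p; exists (psize p), (emb (pmx p)); rewrite vcl_emb; split=> //.
exact: iproj_emb.
Qed.

Definition mequiv n m (P : 'M[B]_n) (Q : 'M[B]_m) :=
  exists W : 'M[B]_(n, m), [/\ W *m madj W = P, madj W *m W = Q & P *m W = W].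

Lemma vcl_eqP n m (P : 'M[B]_n.+1) (Q : 'M[B]_m.+1) : iproj P -> iproj Q ->
  (vcl P = vcl Q <-> mequiv P Q).
Proof.
move=> PP QQ; rewrite /vcl; case: pselect => // PP'; case: pselect => // QQ'.
rewrite V_classP /murray_von_neumann /=; have [PI QI] := (PP.2, QQ.2); split.
  move=> [w [wP PE QE]]; exists (emb w).
  rewrite -emb_adj -!embM -PE -QE !unembK //; split=> //.
  by rewrite -[P in LHS](unembK PI) -embM PE wP.
(* An equivalence over the unitization descends to [A]: [W = P W] has its entries in the ideal
   because [P] has. *)
move=> [W [WW WaW PW]]; have WI : mideal W by rewrite -PW; apply: midealMl.
have WE := unembK WI; exists (unemb W); split; rewrite /partial_isometry.
- by apply: emb_inj; rewrite !embM emb_adj WE WW PW.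
- by apply: emb_inj; rewrite embM emb_adj WE unembK.
- by apply: emb_inj; rewrite embM emb_adj WE unembK.
Qed.

Lemma iproj_block n m (P : 'M[B]_n) (Q : 'M[B]_m) : iproj P -> iproj Q ->
  iproj (block_mx P 0 0 Q).
Proof.
move=> [[Psa PP] PI] [[Qsa QQ] QI]; split.
  split; first by rewrite madj_block Psa Qsa !madj0.
  by rewrite mulmx_block !mulmx0 !mul0mx PP QQ !addr0 add0r.
by apply: mideal_block => //; exact: mideal0.
Qed.

Lemma vcl_block n m (P : 'M[B]_n.+1) (Q : 'M[B]_m.+1) : iproj P -> iproj Q ->
  vcl (block_mx P 0 0 Q : 'M[B]_((n + m.+1).+1)) = vcl P + vcl Q.
Proof.
move=> PP QQ; have [PI QI] := (PP.2, QQ.2).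
pose p := Projection (unemb_adj PP) (unemb_idem PP).
pose q := Projection (unemb_adj QQ) (unemb_idem QQ).
have pE : emb (pmx p) = P by rewrite unembK.
have qE : emb (pmx q) = Q by rewrite unembK.
have -> : vcl P = V_class p by rewrite -pE; exact: (vcl_emb p).
have -> : vcl Q = V_class q by rewrite -qE; exact: (vcl_emb q).
have i0 k l : map_mx (@inA R A) (0 : 'M[A]_(k, l)) = 0 by apply/matrixP => i j; rewrite !mxE.
have E : map_mx (@inA R A) (block_mx (pmx p) 0 0 (pmx q)) = block_mx P 0 0 Q.
  by rewrite map_block_mx !i0; congr block_mx.
by rewrite -[RHS]/(V_add _ _) V_addE -(vcl_emb (dsum p q)) -E.
Qed.

Lemma iproj0 n : iproj (0 : 'M[B]_n).
Proof. by split; [split; rewrite ?madj0 ?mul0mx|exact: mideal0]. Qed.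

Lemma vcl0 n : vcl (0 : 'M[B]_n.+1) = 0.
Proof.
have -> : 0 = vcl (0 : 'M[B]_1) :> V A.
  rewrite -[LHS]/(V_class (proj0 A)) -vcl_emb; congr vcl.
  by apply/matrixP => i j; rewrite !mxE.
apply/vcl_eqP; [exact: iproj0|exact: iproj0|exists 0].
by rewrite !mul0mx mulmx0.
Qed.

Lemma iprojD n (P Q : 'M[B]_n) : iproj P -> iproj Q -> P *m Q = 0 -> iproj (P + Q).
Proof.
move=> [[Psa PP] PI] [[Qsa QQ] QI] PQ; split; last exact: midealD.
have QP : Q *m P = 0 by rewrite -Psa -Qsa -madjM PQ madj0.
split; first by rewrite madjD Psa Qsa.
by rewrite mulmxDl !mulmxDr PP PQ QP QQ addr0 add0r.
Qed.

Lemma vclD n (P Q : 'M[B]_n.+1) : iproj P -> iproj Q -> P *m Q = 0 ->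
  vcl (P + Q) = vcl P + vcl Q.
Proof.
move=> PP QQ PQ; have [[[Psa Pi] _] [[Qsa Qi] _]] := (PP, QQ).
have QP : Q *m P = 0 by rewrite -Psa -Qsa -madjM PQ madj0.
suff H : mequiv (P + Q) (block_mx P 0 0 Q).
  rewrite -vcl_block //; apply/vcl_eqP; [exact: iprojD|exact: (iproj_block PP QQ)|].
  exact: H.
exists (row_mx P Q); split.
- by rewrite madj_row mul_row_col Psa Qsa Pi Qi.
- by rewrite madj_row mul_col_row Psa Qsa Pi Qi PQ QP.
- by rewrite mul_mx_row !mulmxDl Pi Qi PQ QP addr0 add0r.
Qed.

(** An equivalence [W] with the zero projection vanishes for algebraic reasons: [W = W W^* W] and
    [W^* W = 0]. *)
Lemma V_conical (x y : V A) : x + y = 0 -> x = 0.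
Proof.
have [n [P [PP ->]]] := vcl_surj x; have [m [Q [QQ ->]]] := vcl_surj y.
rewrite -vcl_block // -(vcl0 0) => H.
have [W [WW WaW PW]] : mequiv (block_mx P 0 0 Q) (0 : 'M[B]_1).
  have PQ := iproj_block PP QQ; have Z := iproj0 1.
  by apply/(vcl_eqP PQ Z).
suff -> : P = 0 by rewrite !vcl0.
have W0 : W = 0 by rewrite -PW -WW -mulmxA WaW mulmx0.
have : block_mx P 0 0 Q = 0 by rewrite -WW W0 mul0mx.
by rewrite -block_mx0 => /eq_block_mx[].
Qed.

Lemma iproj_scalar (e : B) : uproj e -> in_ideal e -> iproj (e%:M : 'M[B]_1).
Proof.
move=> [esa ee] eI; split; last exact/mideal_scalar.
by split; [rewrite madj_scalar esa|rewrite -scalar_mxM ee].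
Qed.

(** [X^* X] is a subprojection of [Q] equivalent to [r]. That [r] lies in [A] is a conclusion, from
    [X = X Q]; thus [r] may come from a splitting of 1. *)
Lemma iproj_cut n (Q : 'M[B]_n.+1) (r : B) (X : 'M[B]_(1, n.+1)) : iproj Q -> uproj r ->
  X *m madj X = r%:M -> r%:M *m X = X -> X *m Q = X ->
  [/\ in_ideal r, iproj (Q - madj X *m X), (Q - madj X *m X) *m Q = Q - madj X *m X &
      vcl Q = vcl (r%:M : 'M[B]_1) + vcl (Q - madj X *m X)].
Proof.
move=> QP rproj Xr rX XQ; have [[Qsa QQ] QI] := QP; have [rsa rr] := rproj.
have XI : mideal X by rewrite -XQ; apply: midealMr.
have rI : in_ideal r by apply/mideal_scalar; rewrite -Xr; apply: midealMl.
have QX : Q *m madj X = madj X by rewrite -{1}Qsa -madjM XQ.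
have [T T_def] : {T | T = madj X *m X} by eexists.
have TQ : T *m Q = T by rewrite T_def -mulmxA XQ.
have QT : Q *m T = T by rewrite T_def mulmxA QX.
have Tsa : madj T = T by rewrite T_def madjM madjK.
have TT : T *m T = T by rewrite T_def -mulmxA (mulmxA X) Xr rX.
have TI : mideal T by rewrite T_def; apply: midealMr.
have TP : iproj T by [].
have DP : iproj (Q - T).
  split; last exact: midealB.
  split; first by rewrite madjD madjN Qsa Tsa.
  by rewrite mulmxBl !mulmxBr QQ QT TQ TT subrr subr0.
rewrite -T_def; split=> //; first by rewrite mulmxBl QQ TQ.
have TD : T *m (Q - T) = 0 by rewrite mulmxBr TQ TT subrr.
have QE : Q = T + (Q - T) by rewrite addrC subrK.
rewrite [in LHS]QE (vclD TP DP TD); suff -> : vcl T = vcl (r%:M : 'M[B]_1) by [].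
apply/vcl_eqP => //; first exact: iproj_scalar.
exists (madj X); rewrite madjK T_def; split=> //.
by rewrite -mulmxA Xr -[RHS](congr1 (@madj _ _ _ _) rX) madjM madj_scalar rsa.
Qed.

End ClassesOfProjections.

(** * Refinement of V(A) *)

(** Riesz refinement with one summand fixed. In this form it is additive in [x], so generators of
    the monoid suffice. *)
Definition exchange_element (M : nmodType) (x : M) := forall y u v : M, x + y = u + v ->
  exists x1 x2 u' v', [/\ x = x1 + x2, u = x1 + u', v = x2 + v' & y = u' + v'].

Lemma exchange_element0 (M : nmodType) : exchange_element (0 : M).
Proof. by move=> y u v; rewrite add0r => ->; exists 0, 0, u, v; rewrite !add0r. Qed.

Lemma exchange_elementD (M : nmodType) (x x' : M) :
  exchange_element x -> exchange_element x' -> exchange_element (x + x').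
Proof.
move=> xE xE' y u v; rewrite -addrA => /xE[x1 [x2 [u' [v' [-> -> -> /xE']]]]].
move=> [x1' [x2' [u'' [v'' [-> -> -> ->]]]]].
by exists (x1 + x1'), (x2 + x2'), u'', v''; split; rewrite ?addrA // -!addrA; congr (_ + _);
  rewrite addrCA.
Qed.

Section Refinement.
Variables (R : realType) (A : cstarAlgType R).
Local Notation B := (unitiz A).
Hypothesis dense : sa_units_dense A.

Lemma scalar_exchange (e : B) : uproj e -> in_ideal e ->
  exchange_element (vcl (e%:M : 'M[B]_1)).
Proof.
move=> eproj eI y0 u0 v0.
have [l [Y [YP ->]]] := vcl_surj y0.
have [n [P [PP ->]]] := vcl_surj u0.
have [m [Q [QQ ->]]] := vcl_surj v0.
have eP := iproj_scalar eproj eI; have [esa ee] := eproj.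
have H1 := iproj_block eP YP; have H2 := iproj_block PP QQ.
rewrite -!vcl_block // => /(vcl_eqP H1 H2) E.
have {E} [W] : mequiv (block_mx (e%:M : 'M[B]_1) 0 0 Y) (block_mx P 0 0 Q) := E.
(* The first row of the equivalence accounts for [e], the remaining rows for [Y]. *)
rewrite -[W]vsubmxK; move: (usubmx W) (dsubmx W) => rho kappa {W} [].
rewrite madj_col mul_col_row mul_row_col mul_block_col !mul0mx addr0 add0r.
move=> /eq_block_mx[rr rk _ kk] UE /eq_col_mx[erho Yk].
pose Q1 : 'M[B]_(n.+1 + m.+1) := block_mx P 0 0 0.
pose Q2 : 'M[B]_(n.+1 + m.+1) := block_mx 0 0 0 Q.
have Q1P : iproj Q1 := iproj_block PP (iproj0 _ _).
have Q2P : iproj Q2 := iproj_block (iproj0 _ _) QQ.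
have UE' : madj rho *m rho + madj kappa *m kappa = Q1 + Q2.
  by rewrite UE add_block_mx !addr0 !add0r.
have Q12 : Q1 *m Q2 = 0.
  by rewrite mulmx_block !mulmx0 !mul0mx !addr0 block_mx0.
have [r [s [X1 [X2 [W [rs [X11 rX1 X1Q] [X22 sX2 X2Q] [WW WaW PW]]]]]]] :=
  exchange_mx dense eproj Q1P.1 Q2P.1 Q12 erho rr rk UE'.
have [rproj sproj r_s s_r rDs] := rs.
have [rI D1P D1Q V1] := iproj_cut Q1P rproj X11 rX1 X1Q.
have [sI D2P D2Q V2] := iproj_cut Q2P sproj X22 sX2 X2Q.
exists (vcl (r%:M : 'M[B]_1)), (vcl (s%:M : 'M[B]_1)),
  (vcl (Q1 - madj X1 *m X1 : 'M[B]_((n + m.+1).+1))),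
  (vcl (Q2 - madj X2 *m X2 : 'M[B]_((n + m.+1).+1))).
split.
- rewrite -rDs scalar_mx_add vclD //; [exact: iproj_scalar|exact: iproj_scalar|].
  by rewrite -scalar_mxM r_s raddf0.
- by rewrite -V1 vcl_block ?vcl0 ?addr0 //; exact: iproj0.
- by rewrite -V2 vcl_block ?vcl0 ?add0r //; exact: iproj0.
have D12 : (Q1 - madj X1 *m X1) *m (Q2 - madj X2 *m X2) = 0.
  by rewrite -D1Q -[X in _ *m X](proj1 D2P.1) -D2Q madjM (proj1 Q2P.1) -mulmxA (mulmxA Q1)
     Q12 mul0mx mulmx0.
rewrite -vclD //; apply/vcl_eqP => //; first exact: iprojD.
by exists W; rewrite WW WaW; split=> //; apply: PW.
Qed.

Inductive scalar_generated : V A -> Prop :=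
  | scalar_generated0 : scalar_generated 0
  | scalar_generatedS (e : B) x : uproj e -> in_ideal e -> scalar_generated x ->
      scalar_generated (vcl (e%:M : 'M[B]_1) + x).

(** Induction on the size, exchanging the first basis row, with [e = 1], against [P] and [1 - P].
    This cuts from [P] a copy of a projection [r] of [A]; the rest [D] lies under [W^* W], and [W]
    moves it into matrices of one size less. *)
Lemma vcl_scalar_generated n (P : 'M[B]_n.+1) : iproj P -> scalar_generated (vcl P).
Proof.
elim: n P => [|n IH] P PP.
  have PE : P = (P ord0 ord0)%:M := mx11_scalar P.
  rewrite -[vcl P]addr0 PE; have [[Psa Pi] PI] := PP.
  apply: scalar_generatedS; last exact: scalar_generated0; last exact: PI.
  by split; apply: (@scalar_mx1_inj R A); rewrite /= ?scalar_mxM -?madj_scalar -PE.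
pose rho : 'M[B]_(1, 1 + n.+1) := row_mx 1%:M 0.
pose kappa : 'M[B]_(n.+1, 1 + n.+1) := row_mx 0 1%:M.
have [[Psa Pi] PI] := PP.
have P1 : mproj (1%:M - P).
  split; first by rewrite madjD madjN madj1 Psa.
  by rewrite mulmxBr mulmx1 mulmxBl mul1mx Pi subrr subr0.
have u1 : uproj (1 : B) by split; rewrite ?uadj1 ?mulr1.
have [] := @exchange_mx R A dense (1 + n.+1) n.+1 1 P (1%:M - P) rho kappa u1 PP.1 P1.
- by rewrite mulmxBr mulmx1 Pi subrr.
- by rewrite mul1mx.
- by rewrite madj_row mul_row_col !(madj1, madj0, mulmx1, mulmx0, mul0mx, addr0).
- by rewrite madj_row mul_row_col !(madj1, madj0, mulmx1, mulmx0, mul0mx, addr0).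
- rewrite !madj_row mul_col_row !madj1 !madj0 mul_col_row !(mul1mx, mul0mx, mulmx0, mulmx1).
  by rewrite add_block_mx !addr0 !add0r -scalar_mx_block addrC subrK.
move=> r [s [X1 [X2 [W [[rproj _ _ _ _] [X11 rX1 X1Q] [_ _ X2Q] [WW WaW PW]]]]]].
have [rI DP DQ ->] := iproj_cut (n := 1 + n) PP rproj X11 rX1 X1Q.
apply: scalar_generatedS => //.
move: DP DQ WaW; move: (P - _) => D DP DQ WaW; have [[Dsa Di] DI] := DP.
have PX2 : P *m madj X2 = 0.
  by rewrite -X2Q madjM (proj1 P1) mulmxA mulmxBr mulmx1 Pi subrr mul0mx.
have DD : D *m (madj W *m W) = D.
  rewrite WaW mulmxDr Di -[X in _ + X *m _]DQ -(mulmxA D P) !mulmxBr mulmx1 Pi subrr sub0r.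
  by rewrite (mulmxA P) PX2 mul0mx mulmx0 subr0.
have E2 : (W *m D) *m madj (W *m D) = W *m D *m madj W.
  by rewrite madjM Dsa mulmxA -(mulmxA W) Di.
have E1 : madj (W *m D) *m (W *m D) = D.
  by rewrite madjM Dsa -mulmxA (mulmxA (madj W)) mulmxA DD Di.
have WDP : iproj (W *m D *m madj W).
  split; last by apply: midealMl; apply: midealMr.
  split; first by rewrite !madjM madjK Dsa mulmxA.
  by rewrite -!mulmxA (mulmxA (madj W)) (mulmxA D) DD (mulmxA D) Di.
have -> : vcl D = vcl (W *m D *m madj W).
  symmetry; apply/vcl_eqP => //; exists (W *m D); split=> //.
  by rewrite -!mulmxA (mulmxA (madj W)) (mulmxA D) DD Di.
exact: IH.
Qed.

Lemma V_scalar_generated (x : V A) : scalar_generated x.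
Proof. by have [n [P [PP ->]]] := vcl_surj x; exact: vcl_scalar_generated. Qed.

Lemma V_refinement (x : V A) : exchange_element x.
Proof.
elim: (V_scalar_generated x) => [|e y eproj eI _ IH]; first exact: exchange_element0.
by apply: exchange_elementD IH; exact: scalar_exchange.
Qed.

End Refinement.

(** * Cancellation in refinement monoids *)

Section RefinementMonoid.
Variable M : nmodType.
Implicit Types (x y z a b c d s t : M) (n m : nat).
Hypothesis conical : forall x y, x + y = 0 -> x = 0.
Hypothesis refinement : forall x, exchange_element x.

Lemma alg_leD x y z t : alg_le x y -> alg_le z t -> alg_le (x + z) (y + t).
Proof. by move=> [u <-] [v <-]; exists (u + v); rewrite addrACA. Qed.

Lemma alg_le_trans x y z : alg_le x y -> alg_le y z -> alg_le x z.
Proof. by move=> [u <-] [v <-]; exists (u + v); rewrite addrA. Qed.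

Lemma alg_le_refl x : alg_le x x.
Proof. by exists 0; rewrite addr0. Qed.

Lemma alg_leDl x y : alg_le x (x + y).
Proof. by exists y. Qed.

Lemma alg_le_mulrn x y n : alg_le x y -> alg_le (x *+ n) (y *+ n).
Proof. by move=> [u <-]; exists (u *+ n); rewrite mulrnDl. Qed.

Lemma alg_le_split x y z : alg_le x (y + z) ->
  exists y' z', [/\ x = y' + z', alg_le y' y & alg_le z' z].
Proof.
move=> [t /refinement[y' [z' [u [v [-> -> -> _]]]]]].
by exists y', z'; split=> //; exact: alg_leDl.
Qed.

(* Pieces of s lying below x'' are moved, one copy of x'' at a time, until s is
   dominated by a multiple of s'. *)
Lemma refinement_adjust n m s s' x' x'' : alg_le s (s' *+ n + x'' *+ m) ->
  exists t t' y' y'' k, [/\ t + t' = s + s', y' + y'' = x' + x'',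
    t + y' = s + x', t' + y'' = s' + x'' & alg_le t (t' *+ k)].
Proof.
elim: m n s s' x' x'' => [|m IH] n s s' x' x''.
  by rewrite mulr0n addr0 => le; exists s, s', x', x'', n.
rewrite mulrSr addrA => /alg_le_split[s1 [s2 [-> le1 [y'' E]]]].
have {}le1 : alg_le s1 ((s' + s2) *+ (n + m) + y'' *+ m).
  apply: alg_le_trans le1 _; rewrite -E mulrnDl addrA mulrnDr.
  apply: alg_leD (alg_le_refl _); apply: alg_leD; apply: alg_le_mulrn.
    exact: alg_leDl.
  by rewrite addrC; exact: alg_leDl.
have [t [t' [z' [z'' [k [E1 E2 E3 E4 le]]]]]] := IH _ _ _ (x' + s2) _ le1.
exists t, t', z', z'', k; split=> //.
- by rewrite E1 -addrA [s2 + _]addrC.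
- by rewrite E2 -E addrA.
- by rewrite E3 -addrA [s2 + _]addrC.
by rewrite E4 -E addrA.
Qed.

Hypothesis unperf : strictly_unperforated M.

(* The relation [c + s' = c + c + x'] is proportional to [x' < s'] once c is
   below a multiple of s'. *)
Lemma stable_rank_two c x y n : alg_le c (y *+ n) -> c + c + x = c + y ->
  exists g, c + g = c + c /\ y = x + g.
Proof.
move=> cy E; have [c_0|c0] := pselect (c = 0).
  by exists 0; move: E; rewrite c_0 !addr0 !add0r => <-.
have [s [s' [x' [x'' [E1 E2 E3 E4]]]]] := refinement E.
have {cy} : alg_le s (s' *+ n + x'' *+ n).
  by rewrite -mulrnDl -E3; apply: alg_le_trans cy; rewrite E2; exact: alg_leDl.
(* The refinement of [E] is replaced by one in which [t] is below a multiple of [t'], so that [c],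
   being below [c + c = t + t'], is too. *)
move=> /(refinement_adjust x')[t [t' [y' [y'' [k [F1 F2 F3 F4 tk]]]]]].
rewrite -{}E1 in F1; rewrite -{}E2 in F3; rewrite -{}E3 in F4; rewrite -{}E4 in F2.
have [w wE] : alg_le c (t' *+ k.+1).
  apply: (@alg_le_trans _ (c + c)); first exact: alg_leDl.
  by rewrite -F1 mulrSr; apply: alg_leD tk (alg_le_refl _).
have t'c : t' + c = c + y' + c by rewrite -{1}F3 addrA addrC [t' + t]addrC F1 addrA [y' + c]addrC.
have t'cn j : t' *+ j + c = (c + y') *+ j + c.
  elim: j => [|j IH]; first by rewrite !mulr0n.
  by rewrite !mulrSr -[LHS]addrA t'c addrCA IH addrCA addrA.
(* One half of the [2 (k + 1)] copies of [t'] is written as [c + w]; this [c] lets [t'cn] turn the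
   other half into copies of [c + y']. Restoring [c + w] and using [t'c] again leaves [2 (k + 1)]
   copies of [c + y']. *)
have [||g [_ gE]] := unperf (x := y') (y := t') (z := (c + c) *+ k.+1) (n := (k.+1 + k.+1)%N).
- rewrite mulrSr addrA => H; apply: c0; apply: conical (_ : c + ((c + c) *+ k + c) = 0).
  by rewrite -[RHS]H addrCA addrA.
- rewrite !mulrnDr -{2}wE [RHS]addrA t'cn -[RHS]addrA wE -!mulrnDl; congr (_ *+ _).
  by rewrite [RHS]addrC [RHS]addrA t'c [RHS]addrAC -(addrA c) [LHS]addrA [y' + y' + c]addrC.
exists g; split; first by rewrite -{1}F3 -addrA gE F1.
by rewrite -F4 -gE -F2 addrAC.
Qed.

(** With [a = d + d + a'], the equation reads [d + d + (a' + d) = d + b]. Then [b = a' + d + g] with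
    [d + g = d + d], and this is [a]. *)
Lemma order_unit_cancel_double a b d : order_unit b -> alg_le (d + d) a ->
  a + d = b + d -> a = b.
Proof.
move=> [_ bU] [a' <-] E; have [n dn] := bU d.
have [||g [dg ->]] := @stable_rank_two d (a' + d) b n => //.
  by rewrite [d + b]addrC -E addrA addrAC.
by rewrite -[RHS]addrA dg addrC.
Qed.

Hypothesis wdiv : weak_divisibility_for_order_units M.

(** For [a = 2p + 3q] and [d = p + q], one has [2d <= a <= 3d]. So [c] is below a multiple of [d],
    whose copies are cancelled one at a time. *)
Lemma order_unit_cancellation a b c :
  order_unit a -> order_unit b -> a + c = b + c -> a = b.
Proof.
move=> aU bU E; have [p [q aE]] := wdiv aU.
have [d d_def] : {d | d = p + q} by eexists.
have da : alg_le (d + d) a.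
  exists q; rewrite aE d_def mulr2n mulrS mulr2n !addrA; congr (_ + _).
  by rewrite -!addrA; congr (_ + _); rewrite addrCA.
have ad : alg_le a (d *+ 3).
  by exists p; rewrite aE d_def mulrnDl addrAC -mulrSr.
have [m [t tE]] : exists m, alg_le c (d *+ m).
  have [n cn] := aU.2 c; exists (3 * n)%N; apply: alg_le_trans cn _.
  by rewrite mulrnA; exact: alg_le_mulrn.
have {E} : a + d *+ m = b + d *+ m by rewrite -tE !addrA E.
elim: m {t tE} => [|m IH]; first by rewrite mulr0n !addr0.
rewrite mulrSr !addrA => E; apply: IH; apply: (order_unit_cancel_double _ _ E).
  split; first by move=> /conical b0; exact: bU.1.
  move=> x; have [n xn] := bU.2 x; exists n; apply: alg_le_trans xn _.
  by apply: alg_le_mulrn; exact: alg_leDl.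
exact: alg_le_trans da (alg_leDl _ _).
Qed.

End RefinementMonoid.

(** * Full projections *)

Section FullProjections.
Variables (R : realType) (A : cstarAlgType R).
Local Notation B := (unitiz A).
Local Notation N := (@unorm R A).
Local Notation adj := (@uadj R A).
Implicit Types (b c d e p q r s u w x y : B) (v : V A) (eps eta : R).
Hypothesis dense : sa_units_dense A.

(** [1 - 2p] is a self-adjoint unitary. The bound encodes [0 <= p <= 1] as a norm estimate. *)
Lemma uproj_reflection_norm p : uproj p -> N (2^-1 *: 1 - p) <= 2^-1.
Proof.
move=> [psa pp]; have -> : 2^-1 *: 1 - p = 2^-1 *: (1 - 2 *: p) by nc_field R B.
rewrite unormZ ger0_norm ?invr_ge0 // ler_piMr ?invr_ge0 //.
have := @unorm_le_sqrt _ _ (1 - 2 *: p) 1; rewrite sqrtr1; apply.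
rewrite uadjB uadjZ uadj1 psa.
rewrite (_ : _ * _ = 1 - 4 *: p + 4 *: (p * p)); last by nc_ring R B.
by rewrite pp subrK unorm1.
Qed.

(* The part s of q is nearly orthogonal to p; the norm bound comes from
   [unorm_square_le] applied to the positive part of the splitting. *)
Lemma split_along q p eps : uproj q -> uproj p -> 0 < eps ->
  exists r s x, [/\ orth_split q r s, N (s * p) <= eps,
    x * adj x = r, r * x = x & x * p = x].
Proof.
move=> qproj pproj eps0; have [[qsa qq] [psa pp]] := (qproj, pproj).
(* The final estimate is [N (s p s) <= 2 eta + 4 eta + eta]. The bound 1/4 keeps [1/2 - 2 eta]
   nonnegative, and cutting at [2 eta] with error [eta] leaves [r p r >= eta] in the corner of
   [r]. *)
pose eta := Num.min (4^-1) (eps ^+ 2 / 7).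
have eta0 : 0 < eta by rewrite lt_min; apply/andP; split; [lra|rewrite divr_gt0 ?exprn_gt0].
have eta1 : eta <= 4^-1 by rewrite ge_min lexx.
have eta2 : 7 * eta <= eps ^+ 2.
  have : eta <= eps ^+ 2 / 7 by rewrite ge_min lexx orbT.
  lra.
have [||||r [s [m [d [rs msa [l l0 lm] [rm sm] [aE dN dsa qd dq]]]]]] :=
  @spectral_split _ _ dense q (q * p * q - (2 * eta) *: q) eta qproj => //.
- by rewrite uadjB uadjZ !uadjM qsa psa mulrA.
- by rewrite mulrBr !mulrA qq -scalerAr qq.
- by rewrite mulrBl -!mulrA qq -scalerAl qq.
have [qr rq qs sq] := orth_splitP rs.
have [rproj sproj r_s s_r rDs] := rs; have [[rsa rr] [ssa ss]] := (rproj, sproj).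
have [g [{}aE rg sg]] : exists g,
    [/\ q * p * q = (2 * eta) *: q + g * m + d, r * g = r & s * g = - s].
  exists (r - s); split; first by rewrite -addrA -aE addrC subrK.
    by rewrite mulrBr rr r_s subr0.
  by rewrite mulrBr ss s_r sub0r.
have aexp b c : b * q = b -> q * c = c ->
    b * p * c = (2 * eta) *: (b * c) + b * g * (m * c) + b * d * c.
  move=> bq qc; rewrite (_ : b * p * c = b * (q * p * q) * c); last first.
    by rewrite !mulrA bq -(mulrA _ q c) qc.
  by rewrite aE !mulrDr !mulrDl -scalerAr -scalerAl bq !mulrA.
have m0 : upos 0 m.
  by case: lm => C HC; exists C; apply: le_trans HC _; lra.
have hpos : upos eta ((2 * eta)%:A + m + d).
  rewrite (_ : upos eta = upos (2 * eta + 0 - eta)); last by congr upos; ring.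
  by apply: upos_perturb => //; apply: uposD => //; exact: upos_const.
have [|p' [w [[p'sa rp' p'r p'w wp'] [ww _ _ _]]]] := corner_sqrt rproj eta0 hpos.
  by rewrite !uadjD uadjZ uadj1 msa dsa.
have rpr : r * p * r = w * w.
  by rewrite ww (aexp r r) // rg !mulrDr !mulrDl -scalerAr -scalerAl mulr1 !mulrA.
have sps : s * p * s = (2 * eta) *: s - s * m + s * d * s.
  by rewrite (aexp s s) // sg ss mulNr -sm mulrA ss.
exists r, s, (p' * p); split=> //; last 3 first.
- rewrite uadjM psa p'sa mulrA -(mulrA p') pp.
  rewrite (_ : p' * p * p' = p' * (r * p * r) * p'); last by rewrite !mulrA p'r -(mulrA _ r p') rp'.
  by rewrite rpr mulrA p'w -mulrA wp' rr.
- by rewrite mulrA rp'.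
- by rewrite -mulrA pp.
have [z [zsa zz _ zc]] := upos_sqrt l0 lm msa; have sz := zc s sm.
have YY : s * z * (s * z) = s * m by rewrite {2}sz -mulrA (mulrA z) zz -sm mulrA ss.
have smN : N (s * m) <= 4 * eta.
  (* The shift turns [s m] into [s (1/2 - p) s + s d s], of norm at most [1/2 + eta], which is less
     than [(1/2 - 2 eta) + 4 eta]. *)
  rewrite -YY; apply: (@unorm_square_le _ _ s _ (2^-1 - 2 * eta)) => //.
  - by rewrite uadjM zsa ssa sz.
  - by rewrite -mulrA -sz mulrA ss.
  - by rewrite mulrA ss.
  - by lra.
  - by lra.
  rewrite YY.
  have -> : (2^-1 - 2 * eta) *: s + s * m = s * (2^-1 *: 1 - p) * s + s * d * s.
    rewrite mulrBr mulrBl -scalerAr -scalerAl mulr1 ss sps; nc_field R B.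
  apply: le_lt_trans (unormD _ _) _.
  have := unorm_uproj_mul (2^-1 *: 1 - p) sproj sproj; have := unorm_uproj_mul d sproj sproj.
  by have := uproj_reflection_norm pproj; lra.
rewrite -(@ler_pXn2r _ 2) ?nnegrE ?unorm_ge0 ?(ltW eps0) //.
apply: le_trans eta2; rewrite -unorm_adj; apply: le_trans (unorm_cstar_le _) _.
rewrite uadjK uadjM psa ssa mulrA -(mulrA s) pp sps.
apply: le_trans (unormD _ _) _; have := unormB ((2 * eta) *: s) (s * m).
rewrite unormZ ger0_norm; last by lra.
have := unorm_uproj_mul d sproj sproj; have := uproj_norm sproj; have := unorm_ge0 s.
by nra.
Qed.

Inductive below_sum v : nat -> B -> Prop :=
  | below_sum0 : below_sum v 0 0
  | below_sumS p w n b : uproj p -> in_ideal p -> alg_le (vcl (p%:M : 'M[B]_1)) v ->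
      below_sum v n b -> below_sum v n.+1 (p * w + b).

Lemma below_sum_mulr v n b x : below_sum v n b -> below_sum v n (b * x).
Proof.
elim=> [|p w {}n {}b pp pI pv _ IH]; first by rewrite mul0r; exact: below_sum0.
by rewrite mulrDl -mulrA; exact: below_sumS.
Qed.

Lemma below_sumD v n m b c : below_sum v n b -> below_sum v m c -> below_sum v (n + m) (b + c).
Proof.
move=> H cm; elim: H => [|p w {}n {}b pp pI pv _ IH]; first by rewrite add0r.
by rewrite -addrA; exact: below_sumS.
Qed.

Lemma below_sum_unitary v n b u : adj u * u = 1 -> below_sum v n b -> below_sum v n (u * b).
Proof.
move=> uu; elim=> [|p w {}n {}b pp pI pv _ IH]; first by rewrite mulr0; exact: below_sum0.
have [psa pi] := pp.
have p'p : uproj (u * p * adj u).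
  split; first by rewrite !uadjM uadjK psa mulrA.
  by rewrite -!mulrA (mulrA (adj u)) uu mul1r (mulrA p) pi.
have p'I : in_ideal (u * p * adj u) by apply: (in_idealM _ _).1; apply: (in_idealM _ _).2.
rewrite mulrDr (_ : u * (p * w) = u * p * adj u * (u * w)); last first.
  by rewrite -!mulrA (mulrA (adj u)) uu mul1r.
apply: below_sumS => //; rewrite (_ : vcl _ = vcl (p%:M : 'M[B]_1)) //.
apply/vcl_eqP; [exact: iproj_scalar|exact: iproj_scalar|].
exists (u * p)%:M; rewrite madj_scalar uadjM psa -!scalar_mxM; split; congr (_%:M).
- by rewrite mulrA -(mulrA u) pi.
- by rewrite -mulrA (mulrA (adj u)) uu mul1r pi.
by rewrite -!mulrA (mulrA (adj u)) uu mul1r pi.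
Qed.

(** Peel off one term [p w]: the part [r] of [q] is equivalent to a subprojection of [p], while on
    the nearly orthogonal part [s] this term is a small perturbation, so the other terms still
    reproduce [s] after changing [y]. *)
Lemma below_sum_alg_le v n c q y : below_sum v n c -> uproj q -> in_ideal q ->
  q * (c * y) = q -> alg_le (vcl (q%:M : 'M[B]_1)) (v *+ n).
Proof.
move=> H; elim: H q y => [|p w {}n b pp pI pv bn IH] q y qproj qI qc.
  by rewrite -qc mul0r mulr0 raddf0 vcl0; exists 0; rewrite addr0 mulr0n.
(* The inverse of this number bounds [N (s * p)], which forces [N t < 1] below. *)
have wy0 : 0 < 2 * (N (w * y) + 1) by have := unorm_ge0 (w * y); lra.
have eps0 : 0 < (2 * (N (w * y) + 1))^-1 by rewrite invr_gt0.
have [r [s [x [rs spN xx rx xp]]]] := split_along qproj pp eps0.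
have [rproj sproj r_s s_r rDs] := rs; have [qr rq qs sq] := orth_splitP rs.
have [rsa rr] := rproj; have [ssa ss] := sproj.
have rI : in_ideal r by rewrite -qr; apply: (in_idealM _ _).1.
have sI : in_ideal s by rewrite -qs; apply: (in_idealM _ _).1.
pose t := s * p * (w * y) * s.
have t1 : N t < 1.
  have s1 := uproj_norm sproj.
  have := unormM (s * p * (w * y)) s; have := unormM (s * p) (w * y).
  have h : (2 * (N (w * y) + 1))^-1 * N (w * y) < 1.
    by rewrite mulrC ltr_pdivrMr //; have := unorm_ge0 (w * y); lra.
  have h2 : N (s * p) * N (w * y) <= (2 * (N (w * y) + 1))^-1 * N (w * y).
    by rewrite ler_wpM2r ?unorm_ge0.
  by have := unorm_ge0 (s * p * (w * y)); have := unorm_ge0 s; rewrite -/t; nra.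
have [z [tz _ _]] := neumann t1.
have sE : s * (b * (y * (s * z))) = s.
  have E : s * b * y * s = s * (1 - t).
    rewrite mulrBr mulr1 /t !mulrA ss; have := congr1 (fun h => s * h * s) qc.
    by rewrite mulrA sq mulrDl mulrDr mulrDl ss !mulrA addrC => /(canRL (addrK _)).
  by rewrite !mulrA E -mulrA tz mulr1.
have {}sle := IH s _ sproj sI sE.
have {}rle : alg_le (vcl (r%:M : 'M[B]_1)) v.
  apply: alg_le_trans pv.
  have [|||_ _ _ ->] := @iproj_cut _ _ 0 p%:M r x%:M (iproj_scalar pp pI) rproj.
  - by rewrite madj_scalar -scalar_mxM xx.
  - by rewrite -scalar_mxM rx.
  - by rewrite -scalar_mxM xp.
  exact: alg_leDl.
rewrite -rDs scalar_mx_add vclD.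
- by rewrite mulrS; exact: alg_leD.
- exact: iproj_scalar.
- exact: iproj_scalar.
by rewrite -scalar_mxM r_s raddf0.
Qed.

Definition in_closed_ideal v b := forall eps, 0 < eps ->
  exists n c, below_sum v n c /\ N (b - c) < eps.

Lemma in_closed_idealD v b c : in_closed_ideal v b -> in_closed_ideal v c ->
  in_closed_ideal v (b + c).
Proof.
move=> bJ cJ eps eps0; have e2 : 0 < eps / 2 by lra.
have [n [b' [bs bb']]] := bJ _ e2; have [m [c' [cs cc']]] := cJ _ e2.
exists (n + m)%N, (b' + c'); split; first exact: below_sumD.
by rewrite opprD addrACA; apply: le_lt_trans (unormD _ _) _; lra.
Qed.

Lemma in_closed_ideal_closed v : unorm_closed (in_closed_ideal v).
Proof.
move=> b bP eps eps0; have e2 : 0 < eps / 2 by lra.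
have [c cJ bc] := bP _ e2; have [n [c' [cs cc']]] := cJ _ e2.
exists n, c'; split=> //; rewrite -(subrKA c).
by apply: le_lt_trans (unormD _ _) _; lra.
Qed.

Lemma in_closed_ideal0 v : in_closed_ideal v 0.
Proof. by move=> eps eps0; exists 0%N, 0; rewrite subrr unorm0; split=> //; exact: below_sum0. Qed.

Lemma in_closed_ideal_mulr v b x : in_closed_ideal v b -> in_closed_ideal v (b * x).
Proof.
move=> bJ eps eps0; have x0 : 0 < N x + 1 by have := unorm_ge0 x; lra.
have [n [c [cs bc]]] := bJ _ (divr_gt0 eps0 x0).
exists n, (c * x); split; first exact: below_sum_mulr.
rewrite -mulrBl; apply: le_lt_trans (unormM _ _) _.
rewrite ltr_pdivlMr // in bc; apply: le_lt_trans bc.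
by rewrite ler_wpM2l ?unorm_ge0 // lerDl.
Qed.

Lemma in_closed_ideal_unitary v b u : adj u * u = 1 -> in_closed_ideal v b ->
  in_closed_ideal v (u * b).
Proof.
move=> uu bJ eps eps0; have [n [c [cs bc]]] := bJ _ eps0.
exists n, (u * c); split; first exact: below_sum_unitary.
rewrite -mulrBr; apply: le_lt_trans (unormM _ _) _.
have u1 : N u <= 1.
  by have := @unorm_le_sqrt _ _ u 1; rewrite sqrtr1; apply; rewrite uu unorm1.
by apply: le_lt_trans bc; rewrite ler_piMl ?unorm_ge0.
Qed.

Lemma in_closed_idealZ v (k : R) b : in_closed_ideal v b -> in_closed_ideal v (k *: b).
Proof.
have -> : k *: b = b * (k *: 1) by rewrite -scalerAr mulr1.
exact: in_closed_ideal_mulr.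
Qed.

(* A self-adjoint contraction is the real part of a unitary, so the unitaries
   span the algebra. *)
Lemma in_closed_ideal_mull v b x : in_closed_ideal v b -> in_closed_ideal v (x * b).
Proof.
move=> bJ.
have sa h : adj h = h -> in_closed_ideal v (h * b).
  move=> hsa; pose M := N h + 1; have M0 : 0 < M by have := unorm_ge0 h; rewrite /M; lra.
  have Mn0 : M != 0 by rewrite gt_eqF.
  have [k kE] : {k : B | k = M^-1 *: h} by eexists.
  have k1 : N k < 1.
    rewrite kE unormZ ger0_norm ?invr_ge0 ?(ltW M0) // [ltLHS]mulrC ltr_pdivrMr //.
    by rewrite mul1r /M; lra.
  have ksa : adj k = k by rewrite kE uadjZ hsa.
  have [w [wsa ww _ wc]] := sqrt_one_sub_square ksa k1.
  have wk := wc k erefl; pose u := k + uI A * w.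
  have uE : adj u = k - uI A * w by rewrite uadjD uadjM uadjI ksa wsa mulrN -uIC.
  have sq : k * k + w * w = 1 by rewrite ww addrC subrK.
  have Iw : uI A * w * (uI A * w) = - (w * w).
    by rewrite {2}uIC mulrA -(mulrA (uI A)) uIC -!mulrA uII mulrN1 mulrN.
  have kI : k * (uI A * w) = uI A * w * k by rewrite mulrA -uIC -!mulrA wk.
  have uu : adj u * u = 1.
    rewrite uE /u; move: (uI A * w) Iw kI => J Jw kJ.
    rewrite (_ : _ * _ = k * k - J * J + (k * J - J * k)); last by nc_ring R B.
    by rewrite Jw kJ subrr addr0 opprK.
  have uu' : adj (adj u) * adj u = 1.
    rewrite uadjK uE /u; move: (uI A * w) Iw kI => J Jw kJ.
    rewrite (_ : _ * _ = k * k - J * J - (k * J - J * k)); last by nc_ring R B.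
    by rewrite Jw kJ subrr subr0 opprK.
  have -> : h * b = (M / 2) *: (u * b + adj u * b).
    by rewrite uE /u kE; nc_field R B.
  apply: in_closed_idealZ; apply: in_closed_idealD; exact: in_closed_ideal_unitary.
have Ib c : in_closed_ideal v c -> in_closed_ideal v (uI A * c).
  by rewrite uIC; exact: in_closed_ideal_mulr.
(* Real and imaginary parts of [x], the imaginary part being [i (x^* - x) / 2]. *)
have -> : x * b = 2^-1 *: ((x + adj x) * b) + uI A * (2^-1 *: ((uI A * (adj x - x)) * b)).
  rewrite -!scalerAr !mulrA uII mulN1r; nc_field R B.
apply: in_closed_idealD; first by apply: in_closed_idealZ; apply: sa; rewrite uadjD uadjK addrC.
apply/Ib/in_closed_idealZ/sa.
by rewrite uadjM uadjB uadjK uadjI uIC mulrN -mulNr opprB.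
Qed.

End FullProjections.

(** * Full projections give order units *)

Section OrderUnits.
Variables (R : realType) (A : cstarAlgType R).
Local Notation B := (unitiz A).
Hypothesis dense : sa_units_dense A.

Lemma in_closed_ideal_sum (v : V A) I (s : seq I) (F : I -> B) :
  (forall i, in_closed_ideal v (F i)) -> in_closed_ideal v (\sum_(i <- s) F i).
Proof.
by move=> FJ; apply: big_ind => //; [exact: in_closed_ideal0|move=> x y; exact: in_closed_idealD].
Qed.

(** Induction on a decomposition of [x] into classes from [A]: [P] is [W] times a diagonal block
    matrix times [W^*], and the ideal absorbs the entries of [W] on both sides. *)
Lemma in_closed_ideal_entries (v x : V A) n (P : 'M[B]_n.+1) : iproj P -> x = vcl P ->
  (forall e : B, uproj e -> in_ideal e -> alg_le (vcl (e%:M : 'M[B]_1)) x ->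
    in_closed_ideal v e) ->
  forall i j, in_closed_ideal v (P i j).
Proof.
have := V_scalar_generated dense x => xg.
elim: xg n P => [|e {}x eproj eI _ IH] n P PP xP ev.
  have [W [WW WaW PW]] : mequiv P (0 : 'M[B]_1).
    by apply/vcl_eqP => //; [exact: iproj0|rewrite -xP vcl0].
  move=> i j; rewrite -WW -PW -WW -(mulmxA W (madj W) W) WaW mulmx0 mul0mx mxE.
  exact: in_closed_ideal0.
have [m [Q [QP xQ]]] := vcl_surj x.
have eP := iproj_scalar eproj eI.
have eQP := iproj_block eP QP.
have [W [WW WaW PW]] : mequiv P (block_mx (e%:M : 'M[B]_1) 0 0 Q).
  have E : vcl P = vcl (block_mx (e%:M : 'M[B]_1) 0 0 Q : 'M[B]_((0 + m.+1).+1)).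
    by rewrite vcl_block // -xQ.
  exact: (proj1 (vcl_eqP PP eQP) E).
have blockJ i j : in_closed_ideal v ((block_mx (e%:M : 'M[B]_1) 0 0 Q) i j).
  case: (split_ordP i) => i' ->; case: (split_ordP j) => j' ->;
    rewrite ?block_mxEul ?block_mxEur ?block_mxEdl ?block_mxEdr.
  - by rewrite mxE !ord1 eqxx mulr1n; apply: ev => //; exact: alg_leDl.
  - by rewrite mxE; exact: in_closed_ideal0.
  - by rewrite mxE; exact: in_closed_ideal0.
  apply: IH => // f fproj fI fx; apply: ev => //.
  by rewrite addrC; exact: alg_le_trans fx (alg_leDl _ _).
move=> i j.
have -> : P = W *m block_mx (e%:M : 'M[B]_1) 0 0 Q *m madj W.
  by rewrite -WaW mulmxA WW PW WW.
rewrite mxE; apply: in_closed_ideal_sum => k; apply: in_closed_ideal_mulr.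
by rewrite mxE; apply: in_closed_ideal_sum => l; exact: in_closed_ideal_mull.
Qed.

(** The matrices with entries in this ideal form a closed two-sided ideal containing [pmx p], hence
    contain every constant matrix. *)
Lemma full_in_closed_ideal (p : projection A) (a : A) : full p ->
  in_closed_ideal (V_class p) (inA a).
Proof.
move=> pfull.
pose I := [set X : 'M[A]_((psize p).+1) | forall i j, in_closed_ideal (V_class p) (inA (X i j))].
have Iideal : two_sided_ideal I.
  split=> [i j|X Y XI YI i j|k X XI i j|X Y YI].
  - by rewrite mxE; exact: in_closed_ideal0.
  - by rewrite mxE inA_D; exact: in_closed_idealD.
  (* Only real scalars act on [B]; a complex scalar acts as the element [(0, k)]. *)
  - rewrite mxE (_ : inA _ = ((0, k) : B) * inA (X i j)); first exact: in_closed_ideal_mull.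
    by apply: unitiz_eq; rewrite /= ?cmul0l ?scaler0 ?addr0 ?add0r ?mulr0.
  split=> i j; rewrite mxE inA_sum; apply: in_closed_ideal_sum => k; rewrite inA_M.
    exact: in_closed_ideal_mull.
  exact: in_closed_ideal_mulr.
have Iclosed : closed I.
  rewrite closure_id; apply/seteqP; split; first exact: subset_closure.
  move=> X XI i j; apply: in_closed_ideal_closed => eps eps0.
  have e0 : 0 < eps%:C :> R[i] by rewrite ltcR.
  have [|Y [YI /(_ i j) XY]] := XI [set Y | forall i j, ball (X i j) eps%:C (Y i j)].
    by exists (fun i j => ball (X i j) eps%:C) => // k l; exact: nbhsx_ballx.
  exists (inA (Y i j)); first exact: YI.
  rewrite (_ : _ - _ = inA (X i j - Y i j)); last first.
    by apply: unitiz_eq; rewrite /= ?subr0.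
  by apply: le_lt_trans (unorm_inA _) _; exact: ballC_rnorm.
have Ip : I (pmx p).
  move=> i j; have := @in_closed_ideal_entries (V_class p) (V_class p) _ _ (iproj_emb p).
  rewrite vcl_emb => /(_ erefl) H; have := H _ i j; rewrite mxE; apply.
  move=> e eproj eI ep eps eps0; exists 1%N, (e * 1 + 0); split.
    by apply: below_sumS => //; exact: below_sum0.
  by rewrite mulr1 addr0 subrr unorm0.
have : closed_ideal_gen (pmx p) (const_mx a) by rewrite pfull.
move=> /(_ I) H; have /(_ ord0 ord0) : I (const_mx a) by apply: H; split=> // _ ->.
by rewrite mxE.
Qed.

(** For a projection [e] of [A], a sum [c] within distance 1 of [e] makes [e c e] invertible in the
    corner of [e], as [below_sum_alg_le] requires. *)
Lemma full_alg_le (p : projection A) (x : V A) : full p ->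
  exists n, alg_le x (V_class p *+ n).
Proof.
move=> pfull; elim: (V_scalar_generated dense x) => [|e {}x eproj eI _ [n xn]].
  by exists 0%N, 0; rewrite addr0.
have [m [c [cs ec]]] := full_in_closed_ideal e.1 pfull (ltr01 : (0 : R) < 1).
rewrite -in_idealP // in ec; have [esa ee] := eproj.
pose t := e - e * c * e.
have t1 : unorm t < 1.
  apply: le_lt_trans ec; have -> : t = e * (e - c) * e by rewrite mulrBr mulrBl !ee.
  exact: unorm_uproj_mul.
have [y [ty _ _]] := neumann t1.
have ecy : e * (c * (e * y)) = e.
  have E : e * c * e = e * (1 - t) by rewrite /t !mulrBr mulr1 !mulrA ee subKr.
  by rewrite !mulrA E -mulrA ty mulr1.
have em := below_sum_alg_le dense cs eproj eI ecy.
by exists (m + n)%N; rewrite mulrnDr; exact: alg_leD.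
Qed.

End OrderUnits.

Theorem corollary3p11 (R : realType) (A : cstarAlgType R)
  (rr0 : real_rank_zero A)
  (wdiv : weak_divisibility_for_order_units (V A))
  (unperf : strictly_unperforated (V A))
  (a b c : V A) :
  full_class a -> full_class b -> full_class c -> a + c = b + c -> a = b.
Proof.
have dense := real_rank_zero_dense rr0; have conical := @V_conical R A.
move=> [p pfull ->] [q qfull ->] _ E.
(* Order units are nonzero by definition; a full projection of class 0 occurs only when V(A) is
   trivial. *)
have zero (u : projection A) : full u -> V_class u = 0 -> forall x : V A, x = 0.
  move=> ufull u0 x; have [n] := full_alg_le dense x ufull.
  by rewrite u0 mul0rn => -[z /conical].
have [p0|p0] := pselect (V_class p = 0); first by rewrite [RHS](zero p).
have [q0|q0] := pselect (V_class q = 0); first by rewrite [LHS](zero q).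
apply: (order_unit_cancellation conical (V_refinement dense) unperf wdiv _ _ E).
  by split=> // x; exact: full_alg_le.
by split=> // x; exact: full_alg_le.
Qed.
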